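(* Let $\gamma\in\mathbb{Z}^\ell$ with $\gamma_1\ge0$, let $\Psi\subset\Delta^+_\ell$ be a root ideal, and set $a=\mathrm{nr}(\Psi)_1$. Let $R(\gamma)=(\gamma_2,\dots,\gamma_\ell,0)$ and $R(\Psi)=\{(i-1,j-1):(i,j)\in\Psi,\ i>1\}\sqcup\{(i,\ell):i\in[\ell-1]\}$. Then \[ H(\Psi;\gamma;\mathsf w_0^{[a+1,\ell]})=x_1^{\gamma_1}\,\Phi\big(H(R(\Psi);R(\gamma);\mathsf w_0^{[a,\ell]})\big). \]
   Context: Root ideals: upper order ideals of $\Delta^+_\ell=\{(i,j):1\le i<j\le\ell\}$ under $(a,b)\le(c,d)$ iff $a\ge c,b\le d$. $\mathrm{nr}(\Psi)_1=|\{j\in\{1,\dots,\ell\}:(1,j)\notin\Psi\}|$. $H_\ell$ is the 0-Hecke monoid on $\bar s_1,\dots,\bar s_{\ell-1}$ ($\bar s_i^2=\bar s_i$, commutation, braid); for an interval $[i,j]\subset[1,\ell]$, $\mathsf w_0^{[i,j]}$ is the longest element of the submonoid generated by $\bar s_i,\dots,\bar s_{j-1}$ (the identity if $j\le i$). $\pi_i(f)=\frac{x_if-x_{i+1}s_i(f)}{x_i-x_{i+1}}$, $\pi_w$ the composite along any expression. Key polynomials $\kappa_\alpha=\pi_{\mathsf p(\alpha)}\mathbf x^{\alpha^+}$ ($H_\ell$ acts on $\mathbb{Z}^\ell$ via $\bar s_i\alpha=s_i\alpha$ if $\alpha_i\ge\alpha_{i+1}$ else $\alpha$; $\mathsf p(\alpha)$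 shortest with $\mathsf p(\alpha)\alpha^+=\alpha$) form a basis of Laurent polynomials; $\mathrm{poly}(\kappa_\alpha)=\kappa_\alpha$ if $\alpha\ge0$ else $0$ (linear, coefficientwise in $q$). $H(\Psi;\gamma;w)=\pi_w\mathrm{poly}\big(\prod_{(i,j)\in\Psi}(1-qx_i/x_j)^{-1}\mathbf x^\gamma\big)$. $\Phi$ is the $\mathbb{Z}[q]$-algebra homomorphism $x_i\mapsto x_{i+1}$ ($i<\ell$), $x_\ell\mapsto qx_1$. *)

(* Defs.v *)
From HB Require Import structures.
From Stdlib Require Import ClassicalEpsilon.
From mathcomp Require Import all_boot all_order perm all_algebra.
From mathcomp Require Import finmap mpoly.

Set Implicit Arguments.
Unset Strict Implicit.
Unset Printing Implicit Defensive.

Import Order.TTheory GRing.Theory Num.Theory.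
Local Open Scope ring_scope.
Local Open Scope quotient_scope.

(* The number of variables is l = n.+1, so that the first entry of a weight   *)
(* exists. Entries, variables and roots are indexed from 0 by 'I_n.+1; the    *)
(* generator s_i, i : 'I_n, exchanges the entries i and i.+1.                 *)

Definition dec (P : Prop) : bool :=
  if excluded_middle_informative P then true else false.

Lemma decP (P : Prop) : reflect P (dec P).
Proof.
by rewrite /dec; case: excluded_middle_informative => h; constructor.
Qed.

Definition lo n (i : 'I_n) : 'I_n.+1 := widen_ord (leqnSn n) i.
Definition hi n (i : 'I_n) : 'I_n.+1 := lift ord0 i.

Definition sperm n (i : 'I_n) : 'S_n.+1 := tperm (lo i) (hi i).

Section HeckeMonoid.
Variable n : nat.

(* The congruence on the free monoid of words generated by the relations of   *)
(* the 0-Hecke monoid.                                                        *)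
Inductive hecke_eq : seq 'I_n -> seq 'I_n -> Prop :=
| HeckeRefl u : hecke_eq u u
| HeckeSym u v : hecke_eq u v -> hecke_eq v u
| HeckeTrans v u w : hecke_eq u v -> hecke_eq v w -> hecke_eq u w
| HeckeCat u u' v v' :
    hecke_eq u u' -> hecke_eq v v' -> hecke_eq (u ++ v) (u' ++ v')
| HeckeIdem i : hecke_eq [:: i; i] [:: i]
| HeckeComm (i j : 'I_n) : (i.+1 < j)%N -> hecke_eq [:: i; j] [:: j; i]
| HeckeBraid (i j : 'I_n) : i.+1 = j :> nat -> hecke_eq [:: i; j; i] [:: j; i; j].

Definition hecke_rel (u v : seq 'I_n) : bool := dec (hecke_eq u v).

Lemma hecke_rel_refl : reflexive hecke_rel.
Proof. by move=> u; apply/decP; apply: HeckeRefl. Qed.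

Lemma hecke_rel_sym : ssrbool.symmetric hecke_rel.
Proof. by move=> u v; apply/decP/decP; apply: HeckeSym. Qed.

Lemma hecke_rel_trans : transitive hecke_rel.
Proof.
by move=> v u w /decP huv /decP hvw; apply/decP; apply: HeckeTrans huv hvw.
Qed.

Canonical hecke_equiv :=
  EquivRel hecke_rel hecke_rel_refl hecke_rel_sym hecke_rel_trans.

Definition hecke := {eq_quot hecke_equiv}.
HB.instance Definition _ : EqQuotient _ hecke_equiv hecke :=
  EqQuotient.on hecke.
HB.instance Definition _ := Choice.on hecke.

Definition helt (u : seq 'I_n) : hecke := \pi_hecke u.

Lemma hecke_expr (w : hecke) :
  exists k, dec (exists u, size u = k /\ helt u = w).
Proof.
by exists (size (repr w)); apply/decP; exists (repr w); rewrite /helt reprK.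
Qed.

Definition hlen (w : hecke) : nat := ex_minn (hecke_expr w).

(* The generators of the submonoid attached to the interval [i, j] are        *)
(* s_k for i <= k < j in the numbering starting at 1, in which i and j are    *)
(* given: the k-th generator is the element k.-1 of 'I_n.                     *)
Definition hsub (i j : nat) (w : hecke) : Prop :=
  exists u, all (fun k : 'I_n => i <= k.+1 < j)%N u /\ helt u = w.

Definition is_longest (i j : nat) (w : hecke) : Prop :=
  hsub i j w /\ forall v, hsub i j v -> (hlen v <= hlen w)%N.

Definition w0 (i j : nat) : hecke :=
  epsilon (inhabits (helt [::])) (is_longest i j).

End HeckeMonoid.

Notation weight n := ((n.+1).-tuple int).

Section Weights.
Variable n : nat.

Definition sact (i : 'I_n) (al : weight n) : weight n :=
  [tuple tnth al (sperm i k) | k < n.+1].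

Definition hact1 (i : 'I_n) (al : weight n) : weight n :=
  if tnth al (hi i) <= tnth al (lo i) then sact i al else al.

Definition hact_word (u : seq 'I_n) (al : weight n) : weight n := foldr hact1 al u.

Definition hact (w : hecke n) (al : weight n) : weight n := hact_word (repr w) al.

Definition wplus (al : weight n) : weight n := [tuple of sort >=%R al].

Definition is_shortest_to (al : weight n) (w : hecke n) : Prop :=
  hact w (wplus al) = al /\
  forall v, hact v (wplus al) = al -> (hlen w <= hlen v)%N.

Definition pelt (al : weight n) : hecke n :=
  epsilon (inhabits (helt [::])) (is_shortest_to al).

Definition wnonneg (al : weight n) : bool := all (fun c : int => 0 <= c) al.

End Weights.

(* Laurent polynomials over Z are handled inside the field of rational        *)
(* functions in the x_i.                                                      *)
Notation ratfun n := {fraction {mpoly int[n.+1]}}.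

Section Keys.
Variable n : nat.

Definition emb (p : {mpoly int[n.+1]}) : ratfun n := FracField.tofrac p.

Definition x_ (i : 'I_n.+1) : ratfun n := emb 'X_i.

Definition xmon (al : weight n) : ratfun n :=
  \prod_(i < n.+1) x_ i ^ tnth al i.

(* The exchange of the variables i and i.+1, on a numerator and a denominator *)
(* of f; the result does not depend on their choice.                          *)
Definition sfun (i : 'I_n) (f : ratfun n) : ratfun n :=
  emb (msym (sperm i) \n_(repr f)) / emb (msym (sperm i) \d_(repr f)).

Definition pi1 (i : 'I_n) (f : ratfun n) : ratfun n :=
  (x_ (lo i) * f - x_ (hi i) * sfun i f) / (x_ (lo i) - x_ (hi i)).

Definition pi_word (u : seq 'I_n) (f : ratfun n) : ratfun n := foldr pi1 f u.

Definition pi_op (w : hecke n) (f : ratfun n) : ratfun n := pi_word (repr w) f.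

Definition key (al : weight n) : ratfun n := pi_op (pelt al) (xmon (wplus al)).

Definition keysum (c : {fsfun weight n -> int with 0}) : ratfun n :=
  \sum_(al <- finsupp c) key al *~ c al.

(* The coefficients of f in the basis of keys, for f a Laurent polynomial.    *)
Definition keycoef (f : ratfun n) : {fsfun weight n -> int with 0} :=
  epsilon (inhabits [fsfun]) (fun c => keysum c = f).

Definition poly_part (f : ratfun n) : ratfun n :=
  \sum_(al <- finsupp (keycoef f) | wnonneg al) key al *~ keycoef f al.

End Keys.

Notation rootset n := {set 'I_n.+1 * 'I_n.+1}.

Notation qxpoly n := {mpoly {poly int}[n.+1]}.

Section Catalan.
Variable n : nat.

(* Formal power series in q, as sequences of coefficients.                    *)
Definition qseries := nat -> ratfun n.

Definition qone : qseries := fun k => (k == 0%N)%:R.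

Definition qmul (f g : qseries) : qseries :=
  fun k => \sum_(i < k.+1) f i * g (k - i)%N.

(* The expansion of (1 - q u)^-1.                                             *)
Definition qgeom (u : ratfun n) : qseries := fun k => u ^+ k.

Definition root_ideal (Psi : rootset n) : Prop :=
  (forall i j, (i, j) \in Psi -> (i < j)%N) /\
  (forall a b c d : 'I_n.+1, (a, b) \in Psi -> (c < d)%N ->
     (c <= a)%N -> (b <= d)%N -> (c, d) \in Psi).

Definition nr1 (Psi : rootset n) : nat := #|[set j | (ord0, j) \notin Psi]|.

Definition root_series (Psi : rootset n) (ga : weight n) : qseries :=
  fun k => (\big[qmul/qone]_(r in Psi) qgeom (x_ r.1 / x_ r.2)) k * xmon ga.

Definition Hseries (Psi : rootset n) (ga : weight n) (w : hecke n) : qseries :=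
  fun k => pi_op w (poly_part (root_series Psi ga k)).

Definition qcoef (k : nat) (P : qxpoly n) : {mpoly int[n.+1]} :=
  map_mpoly (fun c : {poly int} => c`_k) P.

(* The series above has finitely many nonzero coefficients, all of them       *)
(* polynomials in the x_i: Hcat is this series as an element of Z[q][x].      *)
Definition Hcat (Psi : rootset n) (ga : weight n) (w : hecke n) : qxpoly n :=
  epsilon (inhabits (0 : qxpoly n))
    (fun P : qxpoly n => forall k, emb (qcoef k P) = Hseries Psi ga w k).

Definition Phi (P : qxpoly n) : qxpoly n :=
  P \mPo [tuple if (i < n)%N then 'X_(inord i.+1) else 'X *: 'X_ord0
         | i < n.+1].

Definition Rweight (ga : weight n) : weight n := [tuple of rcons (behead ga) 0].

Definition Rroots (Psi : rootset n) : rootset n :=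
  [set (inord r.1.-1, inord r.2.-1) | r : 'I_n.+1 * 'I_n.+1 in Psi & (0 < r.1)%N]
  :|: [set (i, ord_max) | i : 'I_n.+1 & (i < n)%N].

End Catalan.

(* Main.v *)
(* The key polynomials indexed by weights with a negative entry span a subgroup
   N that is stable under every pi_i and under division by every variable, and
   the Laurent polynomials are the direct sum of N and the polynomials, with
   poly as the projection. The identity pi_i f = s_i f + f + pi_i (f x_{i+1} / x_i)
   on monomials gives, by induction on the exponents, that x^alpha lies in N
   as soon as some tail alpha_j + ... + alpha_l is negative.

   Hence the last column of R(Psi) does not contribute, and poly commutes with
   the shift f |-> x_1^M f(x_2, ..., x_l), M >= 0, of a Laurent polynomial f
   that does not involve x_l. The remaining point is that, for a polynomial p
   in x_1, ..., x_{l-1} symmetric in x_a, ..., x_{l-1}, the coefficient of x_l^k in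
   pi_a ... pi_{l-1} p is congruent to h_k(1/x_a, ..., 1/x_{l-1}) p modulo N.
   Since Phi turns x_l^k into q^k x_1^k, this coefficient is the contribution of
   the first row of Psi. *)

From HB Require Import structures.
From Stdlib Require Import ClassicalEpsilon FunctionalExtensionality.
Require Import Defs.
From mathcomp Require Import all_boot all_order perm all_algebra.
From mathcomp Require Import finmap mpoly zify ring.

Set Implicit Arguments.
Unset Strict Implicit.
Unset Printing Implicit Defensive.

Import Order.TTheory GRing.Theory Num.Theory.
Local Open Scope ring_scope.

(** * Isobaric divided differences in a field *)

(** [w0], [keycoef] and [Hcat] pick witnesses by [epsilon], so each value has to be pinned down:
    [w0] by a normal form for words of the 0-Hecke monoid, [keycoef] by linear independence of the
    keys, [Hcat] by finiteness of the series in [q].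

    The obstacle in the rotation is that [Phi] lives on polynomials and brings in [q], whereas the
    root series consist of Laurent polynomials. It is replaced by the cyclic permutation of the
    variables, a field automorphism that agrees with it wherever [x_l] is absent. This dictates the
    factorization of [pi] at [w0^[a,l]] as [pi_a ... pi_{l-1}] after [pi] at [w0^[a,l-1]]: the
    second operator never touches [x_l] and is carried by the shift to [pi] at [w0^[a+1,l]], the
    operator on the other side of the theorem, while the first one alone creates powers of [x_l].

    Congruences modulo [N] are enough because the coefficients to be compared are polynomials, and
    [N] contains no nonzero polynomial. *)

Section IsobaricField.
Variable F : fieldType.
Implicit Types (s t : {rmorphism F -> F}) (f x y z : F).

(** Stated for an arbitrary ring endomorphism [s] of a field, so that the relations between these
    operators become rational identities that [field] decides. *)
Definition ddiv s x y f : F := (x * f - y * s f) / (x - y).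

Lemma ddivB s x y f g : ddiv s x y (f - g) = ddiv s x y f - ddiv s x y g.
Proof. by rewrite /ddiv rmorphB -mulrBl; congr (_ / _); ring. Qed.

Lemma ddivM_sym s x y f g : s f = f -> ddiv s x y (f * g) = f * ddiv s x y g.
Proof. by move=> sf; rewrite /ddiv rmorphM sf [RHS]mulrA; congr (_ / _); ring. Qed.

Lemma ddiv_sym s x y f : x != y -> s f = f -> ddiv s x y f = f.
Proof. by move=> xy sf; rewrite /ddiv sf; field; rewrite subr_eq0. Qed.

Lemma ddiv_string s x y f : x != y -> x != 0 -> y != 0 -> s x = y -> s y = x ->
  ddiv s x y f = s f + f + ddiv s x y (f * y / x).
Proof.
move=> xy x0 y0 sx sy; rewrite /ddiv !rmorphM fmorphV sx sy.
by field; rewrite subr_eq0 xy x0 y0.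
Qed.

(** The two numerators are [x * s f - y * f] and [y * f - x * s f]. *)
Lemma ddiv_swap s x y f : x != y -> x != 0 -> y != 0 -> s x = y -> s y = x ->
  s (s f) = f -> ddiv s x y (s f) = - ddiv s x y (f * y / x).
Proof.
move=> xy x0 y0 sx sy sK; rewrite /ddiv !rmorphM fmorphV sx sy sK.
by field; rewrite subr_eq0 xy x0 y0.
Qed.

Lemma ddiv_inv s x y f : x != y -> s x = y -> s y = x -> s (s f) = f ->
  s (ddiv s x y f) = ddiv s x y f.
Proof.
move=> xy sx sy sK; rewrite /ddiv fmorph_div !rmorphB !rmorphM sx sy sK.
by field; rewrite !subr_eq0 xy eq_sym xy.
Qed.

Lemma ddiv_comm s t x y z w f : x != y -> z != w ->
  s z = z -> s w = w -> t x = x -> t y = y -> s (t f) = t (s f) ->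
  ddiv s x y (ddiv t z w f) = ddiv t z w (ddiv s x y f).
Proof.
move=> xy zw sz sw tx ty st.
rewrite /ddiv !fmorph_div !rmorphB !rmorphM sz sw tx ty st.
by field; rewrite !subr_eq0 xy zw.
Qed.

(** The hypotheses record the action of [S_3] on the variables and on [f] alone. After rewriting
    with them, both sides are rational expressions in [x], [y], [z] and the six images of [f]. *)
Lemma ddiv_braid s t x y z f : x != y -> y != z -> x != z ->
  s x = y -> s y = x -> s z = z -> t x = x -> t y = z -> t z = y ->
  s (s f) = f -> t (t f) = f -> s (s (t f)) = t f -> t (t (s f)) = s f ->
  s (t (s f)) = t (s (t f)) ->
  ddiv s x y (ddiv t y z (ddiv s x y f)) = ddiv t y z (ddiv s x y (ddiv t y z f)).
Proof.
move=> xy yz xz sx sy sz tx ty tz ss tt sst tts sts.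
rewrite /ddiv !(fmorphV, rmorphB, rmorphM).
rewrite !(sx, sy, sz, tx, ty, tz, ss, tt, sst, tts, sts).
by field; rewrite !subr_eq0 ?(xy, yz, xz, eq_sym z, eq_sym y x).
Qed.

(** Dividing by a moved variable commutes with the operator up to a multiple of [f]. Together with
    [ddivMl] this makes [N] stable under division by the variables. *)
Lemma ddivMr s x y f : x != y -> x != 0 -> y != 0 -> s x = y -> s y = x ->
  x^-1 * ddiv s x y f = ddiv s x y (y^-1 * f) - y^-1 * f.
Proof.
move=> xy x0 y0 sx sy; rewrite /ddiv rmorphM fmorphV sy.
by field; rewrite subr_eq0 xy x0 y0.
Qed.

Lemma ddivMl s x y f : x != y -> x != 0 -> y != 0 -> s x = y -> s y = x ->
  y^-1 * ddiv s x y f = ddiv s x y (x^-1 * f) + y^-1 * f.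
Proof.
move=> xy x0 y0 sx sy; rewrite /ddiv rmorphM fmorphV sx.
by field; rewrite subr_eq0 xy x0 y0.
Qed.

End IsobaricField.

(** * Permutations of the variables on rational functions *)

Definition permf (n : nat) (s : 'S_n.+1) (f : ratfun n) : ratfun n :=
  emb (msym s \n_(repr f)) / emb (msym s \d_(repr f)).

Section PermFrac.
Variable n : nat.
Implicit Types (s t : 'S_n.+1) (f g : ratfun n) (p q : {mpoly int[n.+1]}).
Local Notation K := (ratfun n).

HB.instance Definition _ := GRing.RMorphism.copy (@emb n) (@FracField.tofrac _).

Lemma emb_inj : injective (@emb n).
Proof. by move=> p q /eqP; rewrite /emb tofrac_eq => /eqP. Qed.

Lemma emb_eq0 p : (emb p == 0) = (p == 0).
Proof. exact: tofrac_eq0. Qed.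

Lemma frac_repr f : f = emb \n_(repr f) / emb \d_(repr f).
Proof.
have d0 : \d_(repr f) != 0 by exact: denom_ratioP.
apply: (canRL (mulfK _)); first by rewrite emb_eq0.
rewrite -{1}[f]reprK /emb; unlock FracField.tofrac.
rewrite -[LHS]FracField.pi_mul /FracField.mulf /=.
apply/eqmodP; rewrite /= FracField.equivfE !numden_Ratio ?mulr1 ?mulf_neq0 ?oner_eq0 //.
by rewrite mulrC.
Qed.

Lemma msym_neq0 s p : p != 0 -> msym s p != 0.
Proof. by rewrite -{2}(msym0 _ s) (inj_eq (@inj_msym _ _ s)). Qed.

(** Two representatives of a fraction satisfy a cross-multiplied equality of polynomials, and
    [msym s] preserves it. This removes the dependence of [permf] on the chosen representative. *)
Lemma permfE s p q : q != 0 -> permf s (emb p / emb q) = emb (msym s p) / emb (msym s q).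
Proof.
move=> q0; rewrite /permf; set f := emb p / emb q.
have d0 : \d_(repr f) != 0 by exact: denom_ratioP.
have m0 r : r != 0 -> emb (msym s r) != 0 by rewrite emb_eq0; exact: msym_neq0.
apply/eqP; rewrite eqr_div ?m0 // -!rmorphM; apply/eqP; congr (emb (msym s _)).
apply: emb_inj; apply/eqP; rewrite !rmorphM -eqr_div ?emb_eq0 //.
by rewrite -frac_repr.
Qed.

Lemma frac_ind (P : K -> Prop) :
  (forall p q, q != 0 -> P (emb p / emb q)) -> forall f, P f.
Proof. by move=> H f; rewrite [f]frac_repr; apply: H; exact: denom_ratioP. Qed.

Lemma permf_emb s p : permf s (emb p) = emb (msym s p).
Proof.
by rewrite -[emb p]divr1 -(rmorph1 (@emb n)) permfE ?oner_eq0 // !rmorph1 divr1.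
Qed.

Fact permf_is_zmod_morphism s : zmod_morphism (permf s).
Proof.
elim/frac_ind => p q q0; elim/frac_ind => p' q' q0'.
rewrite -mulNr -rmorphN addf_div ?emb_eq0 // -!rmorphM -rmorphD.
rewrite !permfE ?mulf_neq0 // -mulNr -rmorphN addf_div ?emb_eq0 ?msym_neq0 //.
by rewrite -!rmorphM -rmorphD !(rmorphM, rmorphD, rmorphN).
Qed.

Fact permf_is_monoid_morphism s : monoid_morphism (permf s).
Proof.
split; first by rewrite -{1}(rmorph1 (@emb n)) permf_emb !rmorph1.
elim/frac_ind => p q q0; elim/frac_ind => p' q' q0'.
by rewrite mulf_div -!rmorphM !permfE ?mulf_neq0 // mulf_div -!rmorphM !rmorphM.
Qed.

HB.instance Definition _ s := GRing.isZmodMorphism.Build K K (permf s)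
  (permf_is_zmod_morphism s).
HB.instance Definition _ s := GRing.isMonoidMorphism.Build K K (permf s)
  (permf_is_monoid_morphism s).

Lemma permfM s t f : permf (s * t)%g f = permf t (permf s f).
Proof. by elim/frac_ind: f => p q q0; rewrite !permfE ?msym_neq0 // !msymMm. Qed.

Lemma permf1 f : permf 1%g f = f.
Proof. by elim/frac_ind: f => p q q0; rewrite permfE // !msym1m. Qed.

End PermFrac.

(** * Weights and their sorting *)

Section Weights.
Variable n : nat.
Implicit Types (al be ga : weight n) (i j : 'I_n) (k : 'I_n.+1).
Local Notation "al `[ k ]" := (tnth al k) (at level 2, format "al `[ k ]").

Lemma loE i : lo i = i :> nat. Proof. by []. Qed.
Lemma hiE i : hi i = i.+1 :> nat. Proof. by []. Qed.

Lemma hi_lo i : (hi i == lo i) = false.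
Proof. by rewrite -val_eqE /= /bump /=; lia. Qed.

Lemma sperm_lo i : sperm i (lo i) = hi i. Proof. exact: tpermL. Qed.
Lemma sperm_hi i : sperm i (hi i) = lo i. Proof. exact: tpermR. Qed.
Lemma sperm_other i k : k != lo i -> k != hi i -> sperm i k = k.
Proof. by move=> h1 h2; rewrite tpermD // eq_sym. Qed.
Lemma spermK i k : sperm i (sperm i k) = k. Proof. exact: tpermK. Qed.

Lemma spermE i k : sperm i k = if k == lo i then hi i else if k == hi i then lo i else k.
Proof.
case: eqP => [->|/eqP h1]; first exact: sperm_lo.
by case: eqP => [->|/eqP h2]; [exact: sperm_hi | exact: sperm_other].
Qed.

Lemma tnth_sact i al k : (sact i al)`[k] = al`[sperm i k].
Proof. by rewrite tnth_mktuple. Qed.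

Lemma sactK i al : sact i (sact i al) = al.
Proof. by apply: eq_from_tnth => k; rewrite !tnth_sact spermK. Qed.

Lemma sact_id i al : al`[lo i] = al`[hi i] -> sact i al = al.
Proof.
move=> e; apply: eq_from_tnth => k; rewrite tnth_sact spermE.
by case: eqP => [->|_] //; case: eqP => [->|].
Qed.

(** In this min/max form the idempotence and braid relations for the action are statements about
    ordered integers, within reach of [lia]. *)
Lemma hact1E i al k : (hact1 i al)`[k] =
  if k == lo i then Num.min al`[lo i] al`[hi i] else
  if k == hi i then Num.max al`[lo i] al`[hi i] else al`[k].
Proof.
rewrite /hact1; case: ifP => h.
  rewrite tnth_sact spermE; case: eqP => _; first by lia.
  by case: eqP => _ //; lia.
by case: eqP => [->|_]; [lia | case: eqP => [->|_] //; lia].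
Qed.

Lemma hact1_idem i al : hact1 i (hact1 i al) = hact1 i al.
Proof.
apply: eq_from_tnth => k; rewrite !hact1E !eqxx hi_lo.
by case: eqP => _; [lia | case: eqP => _ //; lia].
Qed.

Lemma hact1_comm i j al : (i.+1 < j)%N -> hact1 i (hact1 j al) = hact1 j (hact1 i al).
Proof.
move=> ij; apply: eq_from_tnth => k; rewrite !hact1E.
have -> : (lo i == lo j) = false by rewrite -val_eqE /=; lia.
have -> : (lo j == lo i) = false by rewrite -val_eqE /=; lia.
have -> : (hi i == hi j) = false by rewrite -val_eqE /= /bump; lia.
have -> : (hi j == hi i) = false by rewrite -val_eqE /= /bump; lia.
have -> : (lo i == hi j) = false by rewrite -val_eqE /= /bump; lia.
have -> : (hi j == lo i) = false by rewrite -val_eqE /= /bump; lia.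
have -> : (lo j == hi i) = false by rewrite -val_eqE /= /bump; lia.
have -> : (hi i == lo j) = false by rewrite -val_eqE /= /bump; lia.
case: (k =P lo i) => [->|_]; last case: (k =P hi i) => [->|_] //.
  have -> : (lo i == lo j) = false by rewrite -val_eqE /=; lia.
  by have -> : (lo i == hi j) = false by rewrite -val_eqE /= /bump; lia.
have -> : (hi i == lo j) = false by rewrite -val_eqE /= /bump; lia.
by have -> : (hi i == hi j) = false by rewrite -val_eqE /= /bump; lia.
Qed.

Lemma lo_succ i j : i.+1 = j :> nat -> lo j = hi i.
Proof. by move=> ij; apply: val_inj; rewrite /= -ij. Qed.

Lemma hact1_braid i j al : i.+1 = j :> nat ->
  hact1 i (hact1 j (hact1 i al)) = hact1 j (hact1 i (hact1 j al)).
Proof.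
move=> ij; apply: eq_from_tnth => k; rewrite !hact1E !eqxx (lo_succ ij).
have ba : (hi i == lo i) = false by exact: hi_lo.
have ab : (lo i == hi i) = false by rewrite eq_sym.
have bc : (hi i == hi j) = false by rewrite -(lo_succ ij) eq_sym; exact: hi_lo.
have cb : (hi j == hi i) = false by rewrite eq_sym.
have ca : (hi j == lo i) = false by rewrite -val_eqE /= /bump; lia.
have ac : (lo i == hi j) = false by rewrite eq_sym.
rewrite !(ab, ba, bc, cb, ac, ca, eqxx).
case: (k =P lo i) => [e|_]; rewrite ?e ?(ab, ba, bc, cb, ac, ca, eqxx); first by lia.
case: (k =P hi i) => [e|_]; rewrite ?e ?(ab, ba, bc, cb, ac, ca, eqxx); first by lia.
by case: (k =P hi j) => [e|_]; rewrite ?e ?(ab, ba, bc, cb, ac, ca, eqxx); lia.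
Qed.

Lemma hact_word_cat u v al : hact_word (u ++ v) al = hact_word u (hact_word v al).
Proof. exact: foldr_cat. Qed.

Lemma hact_word_eq u v al : hecke_eq u v -> hact_word u al = hact_word v al.
Proof.
move=> e; elim: e al => {u v}.
- by [].
- by move=> u v _ IH al.
- by move=> v u w _ IH1 _ IH2 al; rewrite IH1.
- by move=> u u' v v' _ IH1 _ IH2 al; rewrite !hact_word_cat IH2 IH1.
- by move=> i al; exact: hact1_idem.
- by move=> i j ij al; exact: hact1_comm.
- by move=> i j ij al; exact: hact1_braid.
Qed.

Lemma repr_helt (u : seq 'I_n) : hecke_eq (repr (helt u)) u.
Proof.
have : helt (repr (helt u)) = helt u by rewrite /helt reprK.
by move/eqmodP => /Defs.decP.
Qed.

Lemma helt_eq u v : hecke_eq u v -> helt u = helt v :> hecke n.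
Proof. by move=> e; apply/eqmodP; apply/Defs.decP. Qed.

Lemma helt_eqP u v : helt u = helt v :> hecke n -> hecke_eq u v.
Proof. by move/eqmodP => /Defs.decP. Qed.

Lemma hactE u al : hact (helt u) al = hact_word u al.
Proof. exact: hact_word_eq (repr_helt u). Qed.

Definition wadd al be : weight n := [tuple al`[k] + be`[k] | k < n.+1].
Definition wunit k0 (c : int) : weight n := [tuple if k == k0 then c else 0 | k < n.+1].
Definition wstep i al : weight n :=
  wadd al (wadd (wunit (lo i) (-1)) (wunit (hi i) 1)).

Lemma tnth_wadd al be k : (wadd al be)`[k] = al`[k] + be`[k].
Proof. by rewrite tnth_mktuple. Qed.
Lemma tnth_wunit k0 c k : (wunit k0 c)`[k] = if k == k0 then c else 0.
Proof. by rewrite tnth_mktuple. Qed.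

Lemma tnth_wstep i al k : (wstep i al)`[k] =
  al`[k] + (if k == lo i then -1 else if k == hi i then 1 else 0).
Proof.
rewrite !tnth_wadd !tnth_wunit; case: eqP => [->|_]; last by rewrite add0r.
by rewrite eq_sym hi_lo addr0.
Qed.

(** [ga] is an interior lattice point of the segment from [al] to [sact i al]. These are the extra
    monomials that [pi_i] produces from [x^al]. *)
Definition sconv i al ga : Prop :=
  [/\ forall k, k != lo i -> k != hi i -> ga`[k] = al`[k],
      ga`[lo i] + ga`[hi i] = al`[lo i] + al`[hi i] &
      (al`[lo i] < ga`[lo i] < al`[hi i]) || (al`[hi i] < ga`[lo i] < al`[lo i])].

Definition wnorm al : int := \sum_k al`[k] ^+ 2.

Definition ascset al : {set 'I_n.+1 * 'I_n.+1} :=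
  [set p : 'I_n.+1 * 'I_n.+1 | (p.1 < p.2)%N && (al`[p.1] < al`[p.2])].

(** The lexicographic pair (square norm, number of ascending pairs) packed into one number: the
    multiplier exceeds every possible value of the second component. Interior points of a segment
    have smaller norm; undoing an ascent keeps the norm and lowers the second component by one. *)
Definition mu al : nat :=
  (`|wnorm al| * #|{: 'I_n.+1 * 'I_n.+1}|.+1 + #|ascset al|)%N.

Lemma wnorm_ge0 al : 0 <= wnorm al.
Proof. by apply: sumr_ge0 => k _; exact: sqr_ge0. Qed.

Lemma wnorm_split i al : wnorm al = al`[lo i] ^+ 2 + al`[hi i] ^+ 2 +
  \sum_(k | (k != lo i) && (k != hi i)) al`[k] ^+ 2.
Proof.
rewrite /wnorm (bigD1 (lo i)) //= (bigD1 (hi i)) ?hi_lo //= addrA; congr (_ + _).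
Qed.

Lemma wnorm_sact i al : wnorm (sact i al) = wnorm al.
Proof.
rewrite /wnorm [RHS](reindex_inj (@perm_inj _ (sperm i))).
by apply: eq_bigr => k _; rewrite tnth_sact.
Qed.

Lemma wnorm_sconv i al ga : sconv i al ga -> wnorm ga < wnorm al.
Proof.
case=> h1 h2 h3; rewrite !(wnorm_split i).
rewrite (eq_bigr (fun k => al`[k] ^+ 2)); last by move=> k /andP[??]; rewrite h1.
rewrite ltrD2r.
move: h2 h3; move: (al`[lo i]) (al`[hi i]) (ga`[lo i]) (ga`[hi i]) => a b c d.
rewrite !expr2; nia.
Qed.

Lemma mu_sconv i al ga : sconv i al ga -> (mu ga < mu al)%N.
Proof.
move=> /wnorm_sconv h; rewrite /mu.
have : (`|wnorm ga| < `|wnorm al|)%N by have := wnorm_ge0 al; have := wnorm_ge0 ga; lia.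
have : (#|ascset ga| <= #|{: 'I_n.+1 * 'I_n.+1}|)%N by exact: max_card.
move: (`|wnorm ga|)%N (`|wnorm al|)%N (#|ascset _|) (#|ascset _|) (#|{: _}|) => a b c d e.
nia.
Qed.

(** The exchange of [lo i] and [hi i] maps the ascending pairs of [al], except the pair
    [(lo i, hi i)] itself, bijectively onto those of [sact i al]. *)
Lemma mu_asc i al : al`[lo i] < al`[hi i] -> mu al = (mu (sact i al)).+1.
Proof.
move=> asc; rewrite /mu wnorm_sact -addnS; congr (_ + _)%N.
pose F (p : 'I_n.+1 * 'I_n.+1) := (sperm i p.1, sperm i p.2).
have Finj : injective F.
  by move=> [a b] [c d] [/perm_inj -> /perm_inj ->].
have lohi : (lo i, hi i) \in ascset al.
  by rewrite inE /= asc andbT /bump /=; lia.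
rewrite (cardsD1 (lo i, hi i)) lohi add1n -[in RHS](card_imset _ Finj); congr (#|pred_of_set _|.+1).
apply/setP => -[a b].
transitivity (F (a, b) \in ascset (sact i al)); last first.
  have FK : F (F (a, b)) = (a, b) by rewrite /F /= !spermK.
  by rewrite -[in RHS]FK (mem_imset _ _ Finj).
rewrite !inE /= !tnth_sact !spermK xpair_eqE !spermE.
have e1 := loE i; have e2 := hiE i.
case: (altP (a =P lo i)) => [->|a1]; case: (altP (b =P hi i)) => [->|b1] /=.
- by rewrite (hi_lo i) /= /bump /=; symmetry; apply/negbTE; rewrite negb_and; apply/orP; left; lia.
- case: (altP (b =P lo i)) => [->|b2]; first by rewrite ltxx !andbF.
  congr (_ && _); rewrite /bump /=.
  by move: b1 b2; rewrite -!val_eqE /= /bump /=; lia.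
- rewrite hi_lo.
  case: (altP (a =P hi i)) => [->|a2]; first by rewrite ltxx !andbF.
  congr (_ && _); rewrite /bump /=.
  by move: a1 a2; rewrite -!val_eqE /= /bump /=; lia.
case: (altP (a =P hi i)) => [ea|a2]; case: (altP (b =P lo i)) => [eb|b2].
- subst a b; rewrite (ltNge al`[_]) (ltW asc) !andbF //.
- subst a; congr (_ && _); move: b1 b2; rewrite -!val_eqE /= /bump /=; lia.
- subst b; congr (_ && _); move: a1 a2; rewrite -!val_eqE /= /bump /=; lia.
by [].
Qed.

(** One letter raises [mu] by at most one, so a rise of [mu] bounds the length of a Hecke word from
    below. *)
Lemma mu_hact1 i al : (mu al <= mu (hact1 i al) <= (mu al).+1)%N.
Proof.
rewrite /hact1; case: ltgtP => [h|h|h]; rewrite ?leqnn ?leqnSn //; last first.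
  by rewrite sact_id ?h // leqnn leqnSn.
have := @mu_asc i (sact i al); rewrite sactK !tnth_sact sperm_lo sperm_hi => /(_ h) ->.
by rewrite leqnn leqnSn.
Qed.

End Weights.

(** * Demazure operators on monomials *)

Section Subgroups.
Variable V : zmodType.
Implicit Types (B P : V -> Prop) (f g : V).

Definition subgroup P : Prop := P 0 /\ forall f g, P f -> P g -> P (f - g).

Lemma subgroupN P f : subgroup P -> P f -> P (- f).
Proof. by move=> [P0 PB] Pf; rewrite -sub0r; apply: PB. Qed.

Lemma subgroupD P f g : subgroup P -> P f -> P g -> P (f + g).
Proof. by move=> sP Pf Pg; rewrite -[g]opprK; apply: sP.2 => //; apply: subgroupN. Qed.

Lemma subgroup_sum P (J : Type) (r : seq J) (Q : pred J) (F : J -> V) :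
  subgroup P -> (forall j, Q j -> P (F j)) -> P (\sum_(j <- r | Q j) F j).
Proof.
move=> sP H; elim/big_ind: _ => //; first exact: sP.1.
by move=> *; apply: subgroupD.
Qed.

Lemma subgroupMz P f (z : int) : subgroup P -> P f -> P (f *~ z).
Proof.
move=> sP Pf; have Mn m : P (f *+ m).
  by elim: m => [|m IH]; rewrite ?mulr0n ?mulrS; [exact: sP.1 | apply: subgroupD].
by case: z => m; rewrite /intmul; [exact: Mn | apply: subgroupN].
Qed.

Inductive zspan B : V -> Prop :=
| Zspan0 : zspan B 0
| ZspanD f g : B f -> zspan B g -> zspan B (f + g)
| ZspanB f g : B f -> zspan B g -> zspan B (g - f).

Lemma zspan_gen B f : B f -> zspan B f.
Proof. by move=> Bf; rewrite -[f]addr0; apply: ZspanD => //; exact: Zspan0. Qed.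

Lemma zspan_sub B P : subgroup P -> (forall f, B f -> P f) ->
  forall f, zspan B f -> P f.
Proof.
move=> sP BP f; elim=> {f} [|f g Bf _ Pg|f g Bf _ Pg]; first exact: sP.1.
  by apply: subgroupD => //; apply: BP.
by apply: sP.2 => //; apply: BP.
Qed.

Lemma zspan_subgroup B : subgroup (zspan B).
Proof.
split=> [|f g Sf]; first exact: Zspan0.
elim=> {g} [|g h Bg _ IH|g h Bg _ IH]; first by rewrite subr0.
  by rewrite opprD addrCA addrC; apply: ZspanB.
by rewrite opprB addrCA; apply: ZspanD.
Qed.

Lemma zspan_mono B B' f : (forall g, B g -> B' g) -> zspan B f -> zspan B' f.
Proof.
move=> H; apply: zspan_sub; first exact: zspan_subgroup.
by move=> g Bg; apply: zspan_gen; apply: H.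
Qed.

End Subgroups.

Lemma subgroup_preim (V W : zmodType) (phi : {additive V -> W}) (P : W -> Prop) :
  subgroup P -> subgroup (fun f => P (phi f)).
Proof. by move=> sP; split=> [|f g]; rewrite ?raddf0 ?raddfB; [exact: sP.1 | exact: sP.2]. Qed.

Lemma sperm_comm n (i j : 'I_n) : (i.+1 < j)%N ->
  (sperm j * sperm i = sperm i * sperm j)%g.
Proof.
move=> ij; rewrite conjgC; suff -> : (sperm j ^ sperm i = sperm j)%g by [].
by rewrite /sperm tpermJ !tpermD // -val_eqE /= /bump; lia.
Qed.

Lemma sperm_braid n (i j : 'I_n) : i.+1 = j :> nat ->
  (sperm i * (sperm j * sperm i) = sperm j * (sperm i * sperm j))%g.
Proof.
move=> ij; rewrite /sperm (lo_succ ij).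
set a := lo i; set b := hi i; set c := hi j.
have ba : b != a by rewrite /a /b hi_lo.
have cb : c != b by rewrite /b /c -(lo_succ ij) hi_lo.
have ca : c != a by rewrite -val_eqE /= /bump; lia.
have conj (s t : 'S_n.+1) : (s * s = 1)%g -> (s * (t * s) = t ^ s)%g.
  by move=> ss; rewrite conjgE; congr (_ * _)%g; apply: (mulgI s); rewrite ss mulgV.
rewrite -?mulgA !conj ?tperm2 // !tpermJ tpermR tpermL !(tpermD, tpermL, tpermR) //.
all: by rewrite eq_sym.
Qed.

Lemma sact_comm n (i j : 'I_n) al : (i.+1 < j)%N ->
  sact i (sact j al) = sact j (sact i al).
Proof.
move=> ij; apply: eq_from_tnth => k.
by rewrite !tnth_sact -!permM (sperm_comm ij).
Qed.

Lemma sact_braid n (i j : 'I_n) al : i.+1 = j :> nat ->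
  sact i (sact j (sact i al)) = sact j (sact i (sact j al)).
Proof.
move=> ij; apply: eq_from_tnth => k.
by rewrite !tnth_sact -!permM (sperm_braid ij).
Qed.

(* A field containing Z[x_0, ..., x_n], on which the permutations of the variables act. *)
Record symField (n : nat) := SymField {
  sf_sort :> fieldType;
  sf_emb : {rmorphism {mpoly int[n.+1]} -> sf_sort};
  sf_perm : 'S_n.+1 -> {rmorphism sf_sort -> sf_sort};
  sf_emb_inj : injective sf_emb;
  sf_permE : forall s p, sf_perm s (sf_emb p) = sf_emb (msym s p);
  sf_permM : forall (s t : 'S_n.+1) f, sf_perm (s * t)%g f = sf_perm t (sf_perm s f);
  sf_perm1 : forall f, sf_perm 1%g f = f
}.

Section Isobaric.
Variables (n : nat) (F : symField n).
Implicit Types (al be ga : weight n) (i j : 'I_n) (k : 'I_n.+1) (f g : F).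
Local Notation "al `[ k ]" := (tnth al k) (at level 2, format "al `[ k ]").

Definition vx k : F := sf_emb F 'X_k.
Definition mono al : F := \prod_k vx k ^ al`[k].
Local Notation permf := (@sf_perm n F).
Local Notation S_ i := (permf (sperm i)).
Definition dem i f : F := ddiv (S_ i) (vx (lo i)) (vx (hi i)) f.
Definition demw (u : seq 'I_n) f : F := foldr dem f u.

Lemma permf_vx s k : permf s (vx k) = vx (s k).
Proof. by rewrite /vx sf_permE /msym mmapX mmap1U. Qed.

Lemma vx_neq0 k : vx k != 0.
Proof.
rewrite -(rmorph0 (sf_emb F)) (inj_eq (@sf_emb_inj _ F)).
by apply/eqP => /(congr1 (mcoeff U_(k))); rewrite mcoeffX eqxx mcoeff0.
Qed.

Lemma vx_inj : injective vx.
Proof.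
move=> i j /sf_emb_inj /(congr1 (mcoeff U_(j))); rewrite !mcoeffX eqxx.
by case: eqP => // /mnmP /(_ i); rewrite !mnmE eqxx eq_sym; case: eqP.
Qed.

Lemma x_lo_hi i : vx (lo i) != vx (hi i).
Proof. by rewrite (inj_eq (vx_inj)) eq_sym hi_lo. Qed.

Lemma S_lo i : S_ i (vx (lo i)) = vx (hi i).
Proof. by rewrite permf_vx sperm_lo. Qed.
Lemma S_hi i : S_ i (vx (hi i)) = vx (lo i).
Proof. by rewrite permf_vx sperm_hi. Qed.
Lemma S_K i f : S_ i (S_ i f) = f.
Proof. by rewrite -sf_permM /sperm tperm2 sf_perm1. Qed.
Lemma S_other i k : k != lo i -> k != hi i -> S_ i (vx k) = vx k.
Proof. by move=> h1 h2; rewrite permf_vx sperm_other. Qed.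

Fact dem_is_zmod_morphism i : zmod_morphism (dem i).
Proof. by move=> f g; rewrite /dem ddivB. Qed.
HB.instance Definition _ i := GRing.isZmodMorphism.Build F F (dem i)
  (dem_is_zmod_morphism i).

Lemma demM_sym i f g : S_ i f = f -> dem i (f * g) = f * dem i g.
Proof. by move=> sf; rewrite /dem ddivM_sym. Qed.

Lemma dem_sym i f : S_ i f = f -> dem i f = f.
Proof. by move=> sf; rewrite /dem ddiv_sym ?x_lo_hi. Qed.

Lemma S_dem i f : S_ i (dem i f) = dem i f.
Proof. by rewrite /dem; apply: ddiv_inv; rewrite /= ?x_lo_hi ?S_lo ?S_hi ?S_K. Qed.

Lemma dem_idem i f : dem i (dem i f) = dem i f.
Proof. by apply: dem_sym; exact: S_dem. Qed.

Lemma S_comm i j f : (i.+1 < j)%N -> S_ i (S_ j f) = S_ j (S_ i f).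
Proof. by move=> ij; rewrite -!sf_permM (sperm_comm ij). Qed.

Lemma S_braid i j f : i.+1 = j :> nat -> S_ i (S_ j (S_ i f)) = S_ j (S_ i (S_ j f)).
Proof. by move=> ij; rewrite -!sf_permM (sperm_braid ij). Qed.

Lemma dem_comm i j f : (i.+1 < j)%N -> dem i (dem j f) = dem j (dem i f).
Proof.
move=> ij; rewrite /dem; apply: ddiv_comm; last exact: S_comm.
- exact: x_lo_hi.
- exact: x_lo_hi.
all: by apply: S_other; rewrite -val_eqE /= /bump; lia.
Qed.

Lemma dem_braid i j f : i.+1 = j :> nat ->
  dem i (dem j (dem i f)) = dem j (dem i (dem j f)).
Proof.
move=> ij; have e := lo_succ ij; rewrite /dem e.
have h1 := x_lo_hi i; have := x_lo_hi j; rewrite e => h2.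
have h3 : vx (lo i) != vx (hi j) .
  by rewrite (inj_eq (vx_inj)) -val_eqE /= /bump; lia.
have s1 : S_ i (vx (hi j)) = vx (hi j).
  by apply: S_other; rewrite -val_eqE /= /bump; lia.
have s2 : S_ j (vx (lo i)) = vx (lo i).
  by apply: S_other; rewrite -val_eqE /= /bump; lia.
have := S_lo j; have := S_hi j; rewrite e => s3 s4.
apply: (ddiv_braid h1 h2 h3 _ _ s1 s2 s4 s3).
- exact: S_lo.
- exact: S_hi.
- exact: S_K.
- exact: S_K.
- exact: S_K.
- exact: S_K.
- exact: S_braid.
Qed.

Fact demw_is_zmod_morphism u : zmod_morphism (demw u).
Proof. by move=> f g; elim: u => //= i u IH; rewrite IH raddfB. Qed.
HB.instance Definition _ u := GRing.isZmodMorphism.Build F F (demw u)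
  (demw_is_zmod_morphism u).

Lemma demw_cat u v f : demw (u ++ v) f = demw u (demw v f).
Proof. exact: foldr_cat. Qed.

Lemma demw_eq u v f : hecke_eq u v -> demw u f = demw v f.
Proof.
move=> e; elim: e f => {u v}.
- by [].
- by move=> u v _ IH f.
- by move=> v u w _ IH1 _ IH2 f; rewrite IH1.
- by move=> u u' v v' _ IH1 _ IH2 f; rewrite !demw_cat IH2 IH1.
- by move=> i f; exact: dem_idem.
- by move=> i j ij f; exact: dem_comm.
- by move=> i j ij f; exact: dem_braid.
Qed.

Lemma monoD al be : mono (wadd al be) = mono al * mono be.
Proof.
rewrite /mono -big_split /=; apply: eq_bigr => k _.
by rewrite tnth_wadd expfzDr // vx_neq0.
Qed.

Lemma mono_unit k (c : int) : mono (wunit k c) = vx k ^ c.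
Proof.
rewrite /mono (bigD1 k) //= tnth_wunit eqxx big1 ?mulr1 // => j /negbTE jk.
by rewrite tnth_wunit jk expr0z.
Qed.

Lemma permf_mono (s : 'S_n.+1) al :
  permf s (mono al) = mono [tuple al`[(s^-1)%g k] | k < n.+1].
Proof.
rewrite /mono rmorph_prod [RHS](reindex_inj (@perm_inj _ s)) /=.
by apply: eq_bigr => k _; rewrite tnth_mktuple permK fmorphXz permf_vx.
Qed.

Lemma S_mono i al : S_ i (mono al) = mono (sact i al).
Proof. by rewrite permf_mono tpermV. Qed.

Lemma mono_wstep i al : mono (wstep i al) = mono al * vx (hi i) / vx (lo i).
Proof. by rewrite !monoD !mono_unit expr1z exprN1 [_^-1 * _]mulrC mulrA. Qed.

Lemma dem_string i al :
  dem i (mono al) = mono (sact i al) + mono al + dem i (mono (wstep i al)).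
Proof.
rewrite mono_wstep -S_mono.
by rewrite /dem; apply: ddiv_string; rewrite /= ?x_lo_hi ?vx_neq0 ?S_lo ?S_hi.
Qed.

Lemma dem_swap i al : dem i (mono (sact i al)) = - dem i (mono (wstep i al)).
Proof.
rewrite mono_wstep -S_mono.
by rewrite /dem; apply: ddiv_swap; rewrite /= ?x_lo_hi ?vx_neq0 ?S_lo ?S_hi ?S_K.
Qed.

Lemma dem_eq i al : al`[lo i] = al`[hi i] -> dem i (mono al) = mono al.
Proof. by move=> e; apply: dem_sym; rewrite S_mono sact_id. Qed.

(** Here [x_i x^al] is symmetric in the two variables, so the numerator of [pi_i] vanishes. *)
Lemma dem_gap1 i al : al`[hi i] = al`[lo i] + 1 -> dem i (mono al) = 0.
Proof.
move=> e; have E : al = wstep i (sact i al).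
  apply: eq_from_tnth => k; rewrite tnth_wstep tnth_sact spermE.
  case: eqP => [->|_]; first by rewrite e addrK.
  by case: eqP => [->|_]; rewrite ?e // addr0.
rewrite /dem /ddiv S_mono {1}E mono_wstep.
rewrite (_ : _ - _ = 0) ?mul0r //; apply/eqP; rewrite subr_eq0; apply/eqP.
by rewrite mulrC mulfVK ?vx_neq0 // mulrC.
Qed.

Definition mspan (C : weight n -> Prop) : F -> Prop :=
  zspan (fun g => exists2 al, C al & g = mono al).

Lemma mspan_gen (C : weight n -> Prop) al : C al -> mspan C (mono al).
Proof. by move=> Ca; apply: zspan_gen; exists al. Qed.

Lemma mspan_subgroup C : subgroup (mspan C).
Proof. exact: zspan_subgroup. Qed.

Lemma mspan_sub (C : weight n -> Prop) (P : F -> Prop) : subgroup P ->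
  (forall al, C al -> P (mono al)) -> forall f, mspan C f -> P f.
Proof. by move=> sP H; apply: zspan_sub => // f [al Ca ->]; exact: H. Qed.

Lemma mspan_mono (C D : weight n -> Prop) f :
  (forall al, C al -> D al) -> mspan C f -> mspan D f.
Proof.
move=> H; apply: mspan_sub; first exact: mspan_subgroup.
by move=> al Ca; apply: mspan_gen; exact: H.
Qed.

Lemma sconv_trans i al be ga : sconv i al be -> sconv i be ga -> sconv i al ga.
Proof.
case=> h1 h2 h3 [g1 g2 g3]; split; [by move=> k ??; rewrite g1 ?h1 | lia | lia].
Qed.

Lemma wstep_lo i al : (wstep i al)`[lo i] = al`[lo i] - 1.
Proof. by rewrite tnth_wstep eqxx. Qed.

Lemma wstep_hi i al : (wstep i al)`[hi i] = al`[hi i] + 1.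
Proof. by rewrite tnth_wstep hi_lo eqxx. Qed.

Lemma wstep_sconv i al : al`[hi i] + 1 < al`[lo i] -> sconv i al (wstep i al).
Proof.
move=> h; split; rewrite ?tnth_wstep ?eqxx ?hi_lo; [|lia|lia].
by move=> k /negbTE k1 /negbTE k2; rewrite tnth_wstep k1 k2 addr0.
Qed.

Lemma sact_sconv i al be : sconv i al be -> sconv i al (sact i be).
Proof.
case=> h1 h2 h3; split; rewrite ?tnth_sact ?sperm_lo ?sperm_hi; [|lia|lia].
by move=> k k1 k2; rewrite tnth_sact sperm_other ?h1.
Qed.

(** Repeating [dem_string] moves the two exponents towards each other. The recursion stops when they
    are equal, or when they differ by one, the next step then being killed by [dem_gap1]. *)
Lemma dem_wstep_sconv i al : al`[hi i] + 1 < al`[lo i] ->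
  mspan (sconv i al) (dem i (mono (wstep i al))).
Proof.
have [m] := ubnP (`|al`[lo i] - al`[hi i]|)%N; elim: m al => // m IH al hm h.
have sB := mspan_subgroup (sconv i al).
have w0 := wstep_sconv h.
set be := wstep i al.
have elo : be`[lo i] = al`[lo i] - 1 := wstep_lo i al.
have ehi : be`[hi i] = al`[hi i] + 1 := wstep_hi i al.
have [e|ne] := eqVneq be`[lo i] be`[hi i].
  by rewrite dem_eq //; apply: mspan_gen.
rewrite dem_string; apply: subgroupD => //; first apply: subgroupD => //.
- by apply: mspan_gen; apply: sact_sconv.
- exact: mspan_gen.
have [e1|ne1] := eqVneq be`[lo i] (be`[hi i] + 1).
  rewrite dem_gap1; first exact: sB.1.
  by rewrite wstep_lo wstep_hi; lia.
apply: mspan_mono (IH be _ _); [by move=> ga; apply: sconv_trans | lia | lia].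
Qed.

(** [dem_swap] reflects [al] into a descent, and the reflected segment has the same interior
    points. *)
Lemma dem_asc i al : al`[lo i] < al`[hi i] -> mspan (sconv i al) (dem i (mono al)).
Proof.
move=> h; have [e1|ne1] := eqVneq al`[hi i] (al`[lo i] + 1).
  by rewrite dem_gap1 //; exact: (mspan_subgroup _).1.
rewrite -[al in mono al](sactK i) dem_swap; apply: subgroupN; first exact: mspan_subgroup.
apply: mspan_mono (dem_wstep_sconv _); last first.
  by rewrite !tnth_sact sperm_lo sperm_hi; lia.
move=> ga [h1 h2 h3]; split.
- by move=> k k1 k2; rewrite h1 // tnth_sact sperm_other.
- by move: h2; rewrite !tnth_sact sperm_lo sperm_hi; lia.
- by move: h3; rewrite !tnth_sact sperm_lo sperm_hi; lia.
Qed.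

Lemma dem_desc i al : al`[hi i] < al`[lo i] ->
  mspan (sconv i al) (dem i (mono al) - mono al - mono (sact i al)).
Proof.
move=> h; have e (a b c : F) : a + b + c - b - a = c by ring.
rewrite dem_string e.
have [e1|ne1] := eqVneq al`[lo i] (al`[hi i] + 1); last by apply: dem_wstep_sconv; lia.
rewrite dem_gap1; first exact: (mspan_subgroup _).1.
by rewrite wstep_lo wstep_hi; lia.
Qed.

Lemma mspan_dem (C : weight n -> Prop) i f :
  (forall al, C al -> C (sact i al)) ->
  (forall al be, C al -> sconv i al be -> C be) ->
  mspan C f -> mspan C (dem i f).
Proof.
move=> Cs Cc; have sC := mspan_subgroup C.
apply: (mspan_sub (subgroup_preim _ sC)) => al Ca /=.
case: (ltgtP al`[lo i] al`[hi i]) => h.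
- by apply: mspan_mono (dem_asc h) => be; exact: Cc.
- have {}h := dem_desc h.
  rewrite -[dem i _](subrK (mono al)); apply: subgroupD => //; last exact: mspan_gen.
  rewrite -[X in mspan _ X](subrK (mono (sact i al))); apply: subgroupD => //.
    by apply: mspan_mono h => be; exact: Cc.
  by apply: mspan_gen; exact: Cs.
- by rewrite dem_eq //; exact: mspan_gen.
Qed.

(** Solving [dem_string] at [sact i al] for [x^al] expresses it through [pi_i] and monomials of
    smaller [mu]. Membership in a subgroup stable under [pi_i] thus reduces to weights without
    ascents. The predicate [I] allows only some generators to be used, such as those fixing the last
    variable. *)
Lemma mono_span (I : pred 'I_n) (C : weight n -> Prop) (P : F -> Prop) :
  subgroup P -> (forall i f, I i -> P f -> P (dem i f)) ->
  (forall i al, I i -> C al -> al`[lo i] < al`[hi i] -> C (sact i al)) ->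
  (forall i al, I i -> C al -> al`[lo i] + 1 < al`[hi i] -> C (wstep i (sact i al))) ->
  (forall al, C al -> (forall i, I i -> al`[hi i] <= al`[lo i]) -> P (mono al)) ->
  forall al, C al -> P (mono al).
Proof.
move=> sP Ppi Cs Cw Pdom al; have [m] := ubnP (mu al).
elim: m al => // m IH al hm Ca.
case: (pickP (fun i => I i && (al`[lo i] < al`[hi i]))) => [i /andP[Ii h]|no]; last first.
  by apply: Pdom => // i Ii; have := no i; rewrite Ii /= ltNge => /negbFE.
have hmu := mu_asc h.
have Ps : P (mono (sact i al)) by apply: IH; [lia | exact: Cs].
have -> : mono al = dem i (mono (sact i al)) - mono (sact i al)
            - dem i (mono (wstep i (sact i al))).
  by rewrite dem_string sactK; ring.
apply: sP.2; first by apply: sP.2 => //; apply: Ppi.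
(* For a gap of one, [wstep i (sact i al)] is [al] itself, on which the induction hypothesis is
   silent; but [pi_i] kills that monomial. *)
have [e1|ne1] := eqVneq al`[hi i] (al`[lo i] + 1).
  rewrite dem_gap1; first exact: sP.1.
  by rewrite wstep_lo wstep_hi !tnth_sact sperm_lo sperm_hi; lia.
have h2 : al`[lo i] + 1 < al`[hi i] by lia.
apply: Ppi => //; apply: IH; last exact: Cw.
have : sconv i (sact i al) (wstep i (sact i al)).
  by apply: wstep_sconv; rewrite !tnth_sact sperm_lo sperm_hi.
by move/mu_sconv; lia.
Qed.

End Isobaric.

(** * Key polynomials *)

Section SortWeights.
Variable n : nat.
Implicit Types (al be : weight n) (i j : 'I_n) (k : 'I_n.+1).
Local Notation "al `[ k ]" := (tnth al k) (at level 2, format "al `[ k ]").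

Definition dominant al : Prop := forall i, al`[hi i] <= al`[lo i].

Lemma sorted_dominant al : sorted >=%R al <-> dominant al.
Proof.
split=> [/(sortedP 0) h i|h].
  have := h i; rewrite size_tuple ltnS ltn_ord => /(_ isT).
  by rewrite !(tnth_nth 0).
apply/(sortedP 0) => k; rewrite size_tuple ltnS => kn.
by have := h (Ordinal kn); rewrite !(tnth_nth 0).
Qed.

Lemma wplus_dominant al : dominant (wplus al).
Proof. by apply/sorted_dominant/sort_sorted => x y; exact: le_total. Qed.

Lemma wplus_id al : dominant al -> wplus al = al.
Proof.
move/sorted_dominant => h; apply: val_inj => /=; apply: sorted_sort => //.
by move=> x y z /= xy yz; exact: le_trans yz xy.
Qed.

Lemma wplus_sact i al : wplus (sact i al) = wplus al.
Proof.
apply: val_inj; apply/perm_sortP.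
- by move=> x y /=; exact: le_total.
- by move=> x y z /= xy yz; exact: le_trans yz xy.
- by move=> x y /=; rewrite andbC => /le_anti.
by apply/tuple_permP; exists (sperm i).
Qed.

Lemma dominantVasc al : dominant al \/ exists i, al`[lo i] < al`[hi i].
Proof.
case: (pickP (fun i => al`[lo i] < al`[hi i])) => [i h|no]; first by right; exists i.
by left=> i; have := no i; rewrite ltNge => /negbFE.
Qed.

Lemma hact1_sact i al : al`[lo i] < al`[hi i] -> hact1 i (sact i al) = al.
Proof. by move=> h; rewrite /hact1 !tnth_sact sperm_lo sperm_hi ltW // sactK. Qed.

Lemma hact_wplus al : exists u, hact_word u (wplus al) = al.
Proof.
have [m] := ubnP (mu al); elim: m al => // m IH al hm.
case: (dominantVasc al) => [/wplus_id|[i h]]; first by exists [::].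
have [u hu] : exists u, hact_word u (wplus (sact i al)) = sact i al.
  by apply: IH; have := mu_asc h; lia.
by exists (i :: u) => /=; rewrite -(wplus_sact i) hu hact1_sact.
Qed.

(** [pelt] comes from [epsilon], so a shortest element must exist first: undoing a sort gives some
    element, and a least length is attained. *)
Lemma hact_pelt al : hact (pelt al) (wplus al) = al.
Proof.
pose P m := dec (exists w : hecke n, hact w (wplus al) = al /\ hlen w = m).
have exP : exists m, P m.
  have [u hu] := hact_wplus al; exists (hlen (helt u)); apply/Defs.decP.
  by exists (helt u); rewrite hactE.
have shortest : exists w, is_shortest_to al w.
  case: (ex_minnP exP) => m /Defs.decP[w [hw wm]] hmin.
  exists w; split=> // v hv; rewrite wm; apply: hmin; apply/Defs.decP.
  by exists v.
by have [] := epsilon_spec (inhabits (helt [::])) _ shortest.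
Qed.

End SortWeights.

Section Keys.
Variables (n : nat) (F : symField n).
Implicit Types (al be ga : weight n) (i j : 'I_n) (k : 'I_n.+1) (f g : F).
Local Notation "al `[ k ]" := (tnth al k) (at level 2, format "al `[ k ]").
Local Notation mono := (mono F).
Local Notation dem := (@dem n F).
Local Notation mspan := (@mspan n F).

(* [mu al] is enough fuel: it drops by one at each sorting step. *)
Fixpoint kapn (m : nat) al : F :=
  if m is m'.+1 then
    if [pick i | al`[lo i] < al`[hi i]] is Some i then dem i (kapn m' (sact i al))
    else mono al
  else mono al.

Definition kap al : F := kapn (mu al) al.

Lemma kap_dom al : dominant al -> kap al = mono al.
Proof.
move=> h; rewrite /kap; case: (mu al) => //= m; case: pickP => // i.
by rewrite ltNge h.
Qed.

Lemma kap_pick al : dominant al \/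
  exists i, al`[lo i] < al`[hi i] /\ kap al = dem i (kap (sact i al)).
Proof.
case: (dominantVasc al) => [|[i0 h0]]; [by left | right].
rewrite /kap (mu_asc h0) /=; case: pickP => [i h|/(_ i0)]; last by rewrite h0.
exists i; split=> //; congr (dem i (kapn _ _)).
(* Every ascent leaves the same amount of fuel, namely [mu al] less one. *)
by apply: succn_inj; rewrite -mu_asc // -mu_asc.
Qed.

Let Asc al := forall i, al`[lo i] < al`[hi i] -> kap al = dem i (kap (sact i al)).

Lemma far_lookup i j al : (i.+1 < j)%N ->
  [/\ (sact i al)`[lo j] = al`[lo j], (sact i al)`[hi j] = al`[hi j],
      (sact j al)`[lo i] = al`[lo i] & (sact j al)`[hi i] = al`[hi i]].
Proof.
by move=> ij; split; rewrite tnth_sact sperm_other // -val_eqE /= /bump; lia.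
Qed.

Lemma adj_lookup i j al : i.+1 = j :> nat ->
  [/\ lo j = hi i, (sact i al)`[hi j] = al`[hi j] & (sact j al)`[lo i] = al`[lo i]].
Proof.
move=> ij; split; first exact: lo_succ.
  by rewrite tnth_sact sperm_other // -val_eqE /= /bump; lia.
by rewrite tnth_sact sperm_other // -val_eqE /= /bump; lia.
Qed.

Lemma sact_lo i al : (sact i al)`[lo i] = al`[hi i].
Proof. by rewrite tnth_sact sperm_lo. Qed.
Lemma sact_hi i al : (sact i al)`[hi i] = al`[lo i].
Proof. by rewrite tnth_sact sperm_hi. Qed.

(** Local confluence of sorting. Distant ascents commute; for adjacent ones the two choices reach
    the sorted triple along the two sides of the braid relation. *)
Lemma kap_confluence i j al : (forall be, (mu be < mu al)%N -> Asc be) ->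
  al`[lo i] < al`[hi i] -> al`[lo j] < al`[hi j] -> (i < j)%N ->
  dem i (kap (sact i al)) = dem j (kap (sact j al)).
Proof.
move=> IH hi_ hj ij; have mi := mu_asc hi_; have mj := mu_asc hj.
have [far|near] := ltnP i.+1 j.
  have [e1 e2 e3 e4] := far_lookup al far.
  rewrite (IH (sact i al) _ j) ?e1 ?e2 //; last lia.
  rewrite (IH (sact j al) _ i) ?e3 ?e4 //; last lia.
  by rewrite (sact_comm _ far) (dem_comm _ far).
have adj : i.+1 = j :> nat by lia.
have [e e1 e2] := adj_lookup al adj.
have hj' : al`[hi i] < al`[hi j] by rewrite -e.
set be := sact i al in mi e1 *; set ga := sact j al in mj e2 *.
have be_lo : be`[lo i] = al`[hi i] := sact_lo i al.
have be_hi : be`[hi i] = al`[lo i] := sact_hi i al.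
have ga_lo : ga`[hi i] = al`[hi j] by rewrite -e; exact: sact_lo.
have ga_hi : ga`[hi j] = al`[hi i] by rewrite -e; exact: sact_hi.
have [_ f1 f2] := adj_lookup be adj; have [_ g1 g2] := adj_lookup ga adj.
have b1 : be`[lo j] < be`[hi j] by rewrite e be_hi e1; lia.
have c1 : ga`[lo i] < ga`[hi i] by rewrite e2 ga_lo; lia.
have mb := mu_asc b1; have mc := mu_asc c1.
rewrite (IH be _ j b1); last lia.
rewrite (IH ga _ i c1); last lia.
have b2 : (sact j be)`[lo i] < (sact j be)`[hi i].
  by rewrite f2 be_lo -e sact_lo e1.
have c2 : (sact i ga)`[lo j] < (sact i ga)`[hi j].
  by rewrite g1 ga_hi e sact_hi e2.
rewrite (IH _ _ i b2); last lia.
rewrite (IH _ _ j c2); last lia.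
by rewrite (dem_braid _ adj) (sact_braid _ adj).
Qed.

(** Frees the recursion from the ascent that [pick] returns, by local confluence and induction on
    [mu]. *)
Lemma kap_asc i al : al`[lo i] < al`[hi i] -> kap al = dem i (kap (sact i al)).
Proof.
move: i; change (Asc al).
have [m] := ubnP (mu al); elim: m al => // m IH al hm i hi_.
have IH' be : (mu be < mu al)%N -> Asc be by move=> h; apply: IH; lia.
case: (kap_pick al) => [/(_ i)|[j [hj ->]]]; first by rewrite leNgt hi_.
case: (ltngtP i j) => [ij|ji|/val_inj -> //].
  by rewrite (kap_confluence IH' hi_ hj ij).
by rewrite (kap_confluence IH' hj hi_ ji).
Qed.

(** If an ascent at [j] is adjacent to the tie, a second ascent appears after sorting it, and the
    braid relation transports the tie from [i] to [j] in a weight of smaller [mu]. *)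
Lemma kap_tie i al : al`[lo i] = al`[hi i] -> dem i (kap al) = kap al.
Proof.
move: i; have [m] := ubnP (mu al); elim: m al => // m IH al hm i tie.
case: (dominantVasc al) => [/kap_dom ->|[j hj]]; first exact: dem_eq.
have mj := mu_asc hj; rewrite (kap_asc hj).
case: (ltngtP i j) => [ij|ji|/val_inj e]; last by rewrite -e tie ltxx in hj.
  have [far|near] := ltnP i.+1 j.
    have [e1 e2 e3 e4] := far_lookup al far.
    by rewrite (dem_comm _ far) IH //; [lia | rewrite e3 e4].
  have adj : i.+1 = j :> nat by lia.
  have [e e1 e2] := adj_lookup al adj; set be := sact j al in mj e1 e2 *.
  have [_ f1 f2] := adj_lookup be adj.
  have be_lo : be`[hi i] = al`[hi j] by rewrite -e; exact: sact_lo.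
  have be_hi : be`[hi j] = al`[hi i] by rewrite -e; exact: sact_hi.
  have b1 : be`[lo i] < be`[hi i] by rewrite e2 be_lo tie -e.
  have mb := mu_asc b1.
  rewrite (kap_asc b1) (dem_braid _ adj) IH //; first lia.
  by rewrite f1 be_hi e sact_hi e2.
have [far|near] := ltnP j.+1 i.
  have [e1 e2 e3 e4] := far_lookup al far.
  by rewrite -(dem_comm _ far) IH //; [lia | rewrite e1 e2].
have adj : j.+1 = i :> nat by lia.
have [e e1 e2] := adj_lookup al adj; set be := sact j al in mj e1 e2 *.
have [_ f1 f2] := adj_lookup be adj.
have be_lo : be`[lo j] = al`[hi j] := sact_lo j al.
have be_hi : be`[hi j] = al`[lo j] := sact_hi j al.
have b1 : be`[lo i] < be`[hi i] by rewrite e e1 be_hi -tie e.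
have mb := mu_asc b1.
rewrite (kap_asc b1) -(dem_braid _ adj) IH //; first lia.
by rewrite f2 be_lo -e sact_lo e1.
Qed.

(** The operators [pi_i] send keys to keys along the 0-Hecke action, which preserves nonnegativity.
    Hence the spans of the polynomial and of the other keys are both stable. *)
Lemma dem_kap i al : dem i (kap al) = kap (hact1 i al).
Proof.
rewrite /hact1; case: ltgtP => h.
- by rewrite [RHS](@kap_asc i) ?sactK // sact_lo sact_hi.
- by rewrite (kap_asc h) dem_idem.
- by rewrite sact_id ?h // kap_tie.
Qed.

Lemma demw_kap u al : demw u (kap al) = kap (hact_word u al).
Proof. by elim: u => //= i u ->; rewrite dem_kap. Qed.

Lemma kapE al : kap al = demw (repr (pelt al)) (mono (wplus al)).
Proof.
rewrite -(kap_dom (wplus_dominant al)) demw_kap; congr kap.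
by rewrite -[LHS]hact_pelt.
Qed.

Lemma dem_mu_lt i m f : mspan (fun be => mu be < m)%N f ->
  mspan (fun be => mu be < m.+1)%N (dem i f).
Proof.
pose C be : Prop := (mu be < m.+1)%N; have sC : subgroup (mspan C) by exact: mspan_subgroup.
apply: (mspan_sub (subgroup_preim (dem i) sC)) => ga hga /=.
have sub be : sconv i ga be -> C be by move/mu_sconv => ?; rewrite /C; lia.
case: (ltgtP ga`[lo i] ga`[hi i]) => h.
- by apply: mspan_mono (dem_asc F h).
- rewrite -[dem i _](subrK (mono ga)); apply: subgroupD => //; last first.
    by apply: mspan_gen; rewrite /C; lia.
  rewrite -[X in mspan _ X](subrK (mono (sact i ga))); apply: subgroupD => //.
    by apply: mspan_mono (dem_desc F h).
  apply: mspan_gen; rewrite /C.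
  have := @mu_asc n i (sact i ga); rewrite sactK sact_lo sact_hi => /(_ h) ->.
  lia.
- by rewrite dem_eq //; apply: mspan_gen; rewrite /C; lia.
Qed.

(** Undo one ascent: [x^al] appears as the reflection of the leading monomial, and everything else
    that [pi_i] produces has smaller [mu]. *)
Lemma kap_triangular al : mspan (fun be => mu be < mu al)%N (kap al - mono al).
Proof.
have [m] := ubnP (mu al); elim: m al => // m IH al hm.
set C := fun be => _; have sC : subgroup (mspan C) by exact: mspan_subgroup.
case: (dominantVasc al) => [/kap_dom ->|[i h]]; first by rewrite subrr; exact: sC.1.
have mi := mu_asc h; rewrite (kap_asc h); set be := sact i al in mi *.
have hb : be`[hi i] < be`[lo i] by rewrite sact_lo sact_hi.
have -> : dem i (kap be) - mono al = dem i (kap be - mono be)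
    + (dem i (mono be) - mono be - mono (sact i be)) + mono be.
  by rewrite sactK raddfB /=; ring.
apply: subgroupD => //; last by apply: mspan_gen; rewrite /C; lia.
apply: subgroupD => //.
  by rewrite /C mi; apply: dem_mu_lt; apply: IH; lia.
by apply: mspan_mono (dem_desc F hb) => ga /mu_sconv ?; rewrite /C; lia.
Qed.

Lemma mono_emb al (m : 'X_{1..n.+1}) : (forall k, al`[k] = (m k)%:Z) ->
  mono al = sf_emb F 'X_[m].
Proof.
move=> h; rewrite mpolyXE_id rmorph_prod; apply: eq_bigr => k _.
by rewrite h -exprnP rmorphXn.
Qed.

Lemma mspan_coeff (C : weight n -> Prop) g : mspan C g ->
  exists B0 : nat, forall B, (B0 <= B)%N ->
  exists p, sf_emb F p = g * mono [tuple B%:Z | _ < n.+1] /\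
   forall al (m : 'X_{1..n.+1}), ~ C al -> (forall k, al`[k] + B%:Z = (m k)%:Z) -> p@_m = 0.
Proof.
pose P g := exists B0 : nat, forall B, (B0 <= B)%N ->
  exists p, sf_emb F p = g * mono [tuple B%:Z | _ < n.+1] /\
   forall al (m : 'X_{1..n.+1}), ~ C al -> (forall k, al`[k] + B%:Z = (m k)%:Z) -> p@_m = 0.
apply: (mspan_sub (P := P)); first split.
- exists 0%N => B _; exists 0; split; first by rewrite rmorph0 mul0r.
  by move=> *; rewrite mcoeff0.
- move=> f {}g [B1 h1] [B2 h2]; exists (maxn B1 B2) => B; rewrite geq_max => /andP[b1 b2].
  have [p [ep hp]] := h1 B b1; have [q [eq hq]] := h2 B b2.
  exists (p - q); split; first by rewrite rmorphB ep eq mulrBl.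
  by move=> al m nC hm; rewrite mcoeffB (hp al) // (hq al) // subr0.
move=> be Cb; exists (\max_k `|be`[k]|)%N => B hB.
have pos k : 0 <= be`[k] + B%:Z.
  have : (`|be`[k]| <= \max_k `|be`[k]|)%N by exact: leq_bigmax.
  lia.
pose m' : 'X_{1..n.+1} := [multinom absz (be`[k] + B%:Z)%R | k < n.+1].
exists 'X_[m']; split.
  rewrite -monoD; symmetry; apply: mono_emb => k.
  by rewrite tnth_wadd tnth_mktuple mnmE gez0_abs.
move=> al m nC hm; rewrite mcoeffX; case: eqP => // e; case: nC.
suff -> : al = be by [].
apply: eq_from_tnth => k; have := hm k; rewrite -e mnmE gez0_abs // => /addIr //.
Qed.

Lemma mono_indep (C : weight n -> Prop) al (c : int) :
  ~ C al -> mspan C (mono al *~ c) -> c = 0.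
Proof.
move=> nC /mspan_coeff[B0 hB0].
pose B := maxn B0 (\max_k `|al`[k]|)%N.
have [p [ep hp]] := hB0 B (leq_maxl _ _).
have pos k : 0 <= al`[k] + B%:Z.
  have : (`|al`[k]| <= \max_k `|al`[k]|)%N by exact: leq_bigmax.
  by have := leq_maxr B0 (\max_k `|al`[k]|)%N; rewrite -/B; lia.
pose m : 'X_{1..n.+1} := [multinom absz (al`[k] + B%:Z)%R | k < n.+1].
have em k : al`[k] + B%:Z = (m k)%:Z by rewrite mnmE gez0_abs.
have : p = 'X_[m] *~ c.
  apply: (@sf_emb_inj _ F); rewrite ep raddfMz mulrzAl -monoD; congr (_ *~ _).
  by apply: mono_emb => k; rewrite tnth_wadd tnth_mktuple.
move=> e; have := hp al m nC em; rewrite e raddfMz /= mcoeffX eqxx.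
by rewrite -mulrzr mul1r intz.
Qed.

Lemma ex_max_mu (s : seq (weight n)) : s != [::] ->
  exists2 al, al \in s & forall be, be \in s -> (mu be <= mu al)%N.
Proof.
elim: s => // al s IH _; have [->|/IH[be bs hb]] := eqVneq s [::].
  by exists al; rewrite ?inE // => be; rewrite inE => /eqP ->.
have [le|lt] := leqP (mu al) (mu be).
  exists be; first by rewrite inE bs orbT.
  by move=> ga; rewrite inE => /orP[/eqP ->|/hb].
exists al; first by rewrite inE eqxx.
move=> ga; rewrite inE => /orP[/eqP -> //|/hb h]; lia.
Qed.

(** Among the weights with nonzero coefficient take one of maximal [mu]. By triangularity its
    monomial would be a combination of other monomials. *)
Lemma kap_indep (s : seq (weight n)) (c : weight n -> int) : uniq s ->
  \sum_(al <- s) kap al *~ c al = 0 -> forall al, al \in s -> c al = 0.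
Proof.
move=> us e0; pose s' := [seq al <- s | c al != 0].
suff : s' = [::].
  move=> e al als; apply/eqP; apply: contraT => ca.
  have : al \in s' by rewrite mem_filter ca als.
  by rewrite e.
apply/eqP; apply: contraT => /ex_max_mu[al als hmax].
move: (als); rewrite mem_filter => /andP[ca alS].
suff : c al = 0 by move/eqP: ca.
apply: (@mono_indep (fun be => be <> al)); first by apply.
set C := fun be => _; have sC : subgroup (mspan C) by exact: mspan_subgroup.
move: e0; rewrite (bigD1_seq al) //= => /eqP; rewrite addr_eq0 => /eqP e0.
have -> : mono al *~ c al = - (\sum_(be <- s | be != al) kap be *~ c be)
    - (kap al - mono al) *~ c al.
  by rewrite -e0 mulrzBl; ring.
apply: sC.2; last first.
  apply: subgroupMz => //; apply: mspan_mono (kap_triangular al).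
  by move=> be + e; rewrite e ltnn.
apply: subgroupN => //.
rewrite big_seq_cond; apply: subgroup_sum => // be /andP[bs ba].
have [->|cb] := eqVneq (c be) 0; first by rewrite mulr0z; exact: sC.1.
apply: subgroupMz => //; rewrite -[kap be](subrK (mono be)).
apply: subgroupD => //; last by apply: mspan_gen; apply/eqP.
apply: mspan_mono (kap_triangular be) => ga + e; rewrite e.
by have := hmax be; rewrite mem_filter cb bs => /(_ isT); rewrite leqNgt => /negbTE ->.
Qed.

End Keys.

(** * The span of the non-polynomial keys *)

Section Truncation.
Variables (n : nat) (F : symField n).
Implicit Types (al be ga : weight n) (i j : 'I_n) (k : 'I_n.+1) (f g : F).
Local Notation "al `[ k ]" := (tnth al k) (at level 2, format "al `[ k ]").
Local Notation mono := (mono F).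
Local Notation dem := (@dem n F).
Local Notation mspan := (@mspan n F).
Local Notation kap := (@kap n F).
Local Notation vx := (vx F).

Lemma wnonnegP al : reflect (forall k, 0 <= al`[k]) (wnonneg al).
Proof. exact: all_tnthP. Qed.

Lemma wnonneg_sact i al : wnonneg (sact i al) = wnonneg al.
Proof.
apply/wnonnegP/wnonnegP => h k; last by rewrite tnth_sact.
by have := h (sperm i k); rewrite tnth_sact spermK.
Qed.

Lemma wnonneg_hact1 i al : wnonneg (hact1 i al) = wnonneg al.
Proof. by rewrite /hact1; case: ifP => // _; exact: wnonneg_sact. Qed.

(** The subgroup [N], the kernel of [poly]. *)
Definition negs : F -> Prop := zspan (fun g => exists2 al, ~~ wnonneg al & g = kap al).

Lemma negs_subgroup : subgroup negs.
Proof. exact: zspan_subgroup. Qed.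

Lemma negs_dem i f : negs f -> negs (dem i f).
Proof.
apply: (zspan_sub (subgroup_preim (dem i) negs_subgroup)) => _ [al h ->] /=.
by rewrite dem_kap; apply: zspan_gen; exists (hact1 i al); rewrite ?wnonneg_hact1.
Qed.

Lemma negs_demw u f : negs f -> negs (demw u f).
Proof. by move=> h; elim: u => //= i u IH; exact: negs_dem. Qed.

Definition tail (j : nat) al : int := \sum_(k < n.+1 | (j <= k)%N) al`[k].

Lemma tail_wadd (j : nat) al be : tail j (wadd al be) = tail j al + tail j be.
Proof. by rewrite /tail -big_split; apply: eq_bigr => k _; rewrite tnth_wadd. Qed.

Lemma tail_wunit (j : nat) k c : tail j (wunit k c) = if (j <= k)%N then c else 0.
Proof.
rewrite /tail; case: ifP => jk.
  rewrite (bigD1 k) //= tnth_wunit eqxx big1 ?addr0 // => k' /andP[_ /negbTE e].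
  by rewrite tnth_wunit e.
rewrite big1 // => k' jk'; rewrite tnth_wunit; case: eqP => // e.
by rewrite e jk in jk'.
Qed.

Lemma sact_wadd i al (d := al`[hi i] - al`[lo i]) :
  sact i al = wadd al (wadd (wunit (lo i) d) (wunit (hi i) (- d))).
Proof.
apply: eq_from_tnth => k; rewrite tnth_sact !tnth_wadd !tnth_wunit spermE /d.
case: eqP => [->|_]; first by rewrite eq_sym hi_lo; ring.
by case: eqP => [->|_]; ring.
Qed.

Lemma tail_sact (j : nat) i al : al`[lo i] < al`[hi i] -> tail j (sact i al) <= tail j al.
Proof.
move=> h; rewrite sact_wadd !tail_wadd !tail_wunit hiE loE.
by case: (leqP j i) => ?; case: (leqP j i.+1) => ?; lia.
Qed.

Lemma tail_wstep (j : nat) i al : al`[lo i] + 1 < al`[hi i] ->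
  tail j (wstep i (sact i al)) <= tail j al.
Proof.
move=> h; rewrite /wstep sact_wadd !tail_wadd !tail_wunit hiE loE.
by case: (leqP j i) => ?; case: (leqP j i.+1) => ?; lia.
Qed.

Lemma dominant_neg al : dominant al -> ~~ wnonneg al -> negs (mono al).
Proof. by move=> h h0; apply: zspan_gen; exists al; rewrite ?kap_dom. Qed.

(** Undoing an ascent moves weight to the left, so the tail stays negative. A dominant weight with a
    negative tail has a negative entry, and its monomial is its own key. *)
Lemma negs_tail (j : nat) al : tail j al < 0 -> negs (mono al).
Proof.
apply: (@mono_span n F predT (fun al => tail j al < 0)) => {al}.
- exact: negs_subgroup.
- by move=> i f _; exact: negs_dem.
- by move=> i al _ h h1; have := tail_sact j h1; lia.
- by move=> i al _ h h1; have := tail_wstep j h1; lia.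
move=> al h dom; apply: dominant_neg; first by move=> i; exact: dom.
apply/negP => /wnonnegP h0; have : 0 <= tail j al by apply: sumr_ge0.
lia.
Qed.

Lemma mspan_negs (C : weight n -> Prop) f :
  (forall al, C al -> exists j : nat, tail j al < 0) -> mspan C f -> negs f.
Proof.
move=> h; apply: mspan_sub; first exact: negs_subgroup.
by move=> al /h[j]; exact: negs_tail.
Qed.

Lemma polys_kap f : mspan (fun al => wnonneg al) f ->
  zspan (fun g => exists2 al, wnonneg al & g = kap al) f.
Proof.
have sZ := @zspan_subgroup F (fun g => exists2 al, wnonneg al & g = kap al).
apply: mspan_sub => //; apply: (@mono_span n F predT _ _ sZ).
- move=> i f' _; apply: (zspan_sub (subgroup_preim (dem i) sZ)) => _ [al h ->] /=.
  by rewrite dem_kap; apply: zspan_gen; exists (hact1 i al); rewrite ?wnonneg_hact1.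
- by move=> i al _ h _; rewrite wnonneg_sact.
- move=> i al _ /wnonnegP h h1; apply/wnonnegP => k.
  rewrite tnth_wstep tnth_sact spermE; have := h (lo i); have := h k.
  by case: eqP => _; [lia | case: eqP => _; lia].
- by move=> al h dom; apply: zspan_gen; exists al; rewrite ?kap_dom // => i; exact: dom.
Qed.

Lemma dominant_le al k k' : dominant al -> (k <= k')%N -> al`[k'] <= al`[k].
Proof.
move=> dom; have [m] := ubnP k'; elim: m k' => // m IH k' hm.
rewrite leq_eqVlt => /orP[/eqP/val_inj -> //|lt].
have k'n : (k'.-1 < n)%N by have := ltn_ord k'; lia.
have := dom (Ordinal k'n).
have -> : hi (Ordinal k'n) = k' by apply: val_inj; rewrite /= /bump /=; lia.
by move/le_trans; apply; apply: IH => /=; lia.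
Qed.

Lemma tail_last al : tail n al = al`[ord_max].
Proof.
rewrite /tail (big_pred1 ord_max) // => k /=.
by rewrite -val_eqE /=; have := ltn_ord k; lia.
Qed.

Lemma vxV k : (vx k)^-1 = mono (wunit k (-1)).
Proof. by rewrite mono_unit exprN1. Qed.

(** All variables are treated at once, since [ddivMr] and [ddivMl] relate neighbouring ones. By
    induction along the keys only a dominant weight remains; its last entry is its least one, hence
    negative, and stays so after division. *)
Lemma negs_vxV k f : negs f -> negs ((vx k)^-1 * f).
Proof.
pose P f := forall k, negs ((vx k)^-1 * f).
suff : negs f -> P f by move=> h /h; exact.
have sP : subgroup P.
  split=> [k'|f1 f2 h1 h2 k']; first by rewrite mulr0; exact: negs_subgroup.1.
  by rewrite mulrBr; apply: negs_subgroup.2.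
have Pdem i g : P g -> P (dem i g).
  move=> h k'; have [->|k1] := eqVneq k' (lo i).
    rewrite (ddivMr _ (x_lo_hi F i) (vx_neq0 _ _) (vx_neq0 _ _) (S_lo F i) (S_hi F i)).
    by apply: negs_subgroup.2 => //; apply: negs_dem.
  have [->|k2] := eqVneq k' (hi i).
    rewrite (ddivMl _ (x_lo_hi F i) (vx_neq0 _ _) (vx_neq0 _ _) (S_lo F i) (S_hi F i)).
    by apply: subgroupD => //; [exact: negs_subgroup | apply: negs_dem].
  by rewrite -demM_sym ?fmorphV ?S_other //; apply: negs_dem.
apply: zspan_sub => // _ [al h ->].
have [m] := ubnP (mu al); elim: m al h => // m IH al h hm.
case: (dominantVasc al) => [dom|[i asc]]; last first.
  rewrite (kap_asc F asc); apply: Pdem; apply: IH; rewrite ?wnonneg_sact //.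
  by have := mu_asc asc; lia.
move=> k'; rewrite (kap_dom F dom) vxV -monoD; apply: (@negs_tail n).
rewrite tail_wadd tail_wunit tail_last.
have : al`[ord_max] < 0; last by case: ifP => _; lia.
rewrite ltNge; apply: contra h => h; apply/wnonnegP => k''.
by apply: le_trans h (dominant_le dom _); rewrite -ltnS.
Qed.

(** The permutation that sends each variable to the next and the last to the first; it replaces
    [Phi] where the last variable is absent. *)
Definition cyc : 'S_n.+1 := perm (@ordS_inj n.+1).
Local Notation sigma := (sf_perm F cyc).

Lemma cyc_lo i : cyc (lo i) = hi i.
Proof. by apply: val_inj; rewrite permE /= /bump modn_small // ltnS ltn_ord. Qed.

Lemma cyc_max : cyc ord_max = ord0.
Proof. by apply: val_inj; rewrite permE /= modnn. Qed.

Lemma cycV_hi i : (cyc^-1)%g (hi i) = lo i.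
Proof. by rewrite -cyc_lo permK. Qed.

Lemma cycV_0 : (cyc^-1)%g ord0 = ord_max.
Proof. by rewrite -cyc_max permK. Qed.

Lemma hi_lo_succ i i' : i.+1 = i' :> nat -> hi i = lo i'.
Proof. by move=> e; rewrite (lo_succ e). Qed.

Lemma sigma_dem i i' f : i.+1 = i' :> nat -> sigma (dem i f) = dem i' (sigma f).
Proof.
move=> e; have el := hi_lo_succ e; rewrite /dem /ddiv fmorph_div !rmorphB !rmorphM !permf_vx.
have c1 : cyc (lo i) = lo i' by rewrite cyc_lo.
have c2 : cyc (hi i) = hi i' by rewrite el cyc_lo.
suff -> : sigma (sf_perm F (sperm i) f) = sf_perm F (sperm i') (sigma f).
  by rewrite c1 c2.
rewrite -!sf_permM conjgC; suff -> : (sperm i ^ cyc = sperm i')%g by [].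
by rewrite /sperm tpermJ c1 c2.
Qed.

Definition lastzero al : Prop := al`[ord_max] = 0.
Definition fpoly : F -> Prop := mspan (fun al => wnonneg al /\ al`[ord_max] = 0).

Lemma fpoly_subgroup : subgroup fpoly. Proof. exact: mspan_subgroup. Qed.

Lemma ord_max_neq i : (i.+1 < n)%N -> (ord_max != lo i) /\ (ord_max != hi i).
Proof. by move=> h; rewrite -!val_eqE /= /bump; split; lia. Qed.

Lemma fpoly_dem i f : (i.+1 < n)%N -> fpoly f -> fpoly (dem i f).
Proof.
move=> /ord_max_neq[h1 h2]; apply: mspan_dem => [al [h0 hl]|al be [/wnonnegP h0 hl] [c1 c2 c3]].
  by rewrite wnonneg_sact tnth_sact sperm_other.
split; last by rewrite c1.
apply/wnonnegP => k; have a1 := h0 (lo i); have a2 := h0 (hi i).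
have [->|k1] := eqVneq k (lo i); first by lia.
have [->|k2] := eqVneq k (hi i); first by lia.
by rewrite c1.
Qed.

(** One polynomial serves as the truncation both of [f] and of its shifts. The generators used fix
    [x_l]; the shift carries each to the next generator, which fixes [x_1], so [vx ord0 ^+ M] passes
    through. Only weights whose first [l-1] entries decrease remain. *)
Lemma lastzero_split f : mspan lastzero f -> exists p, [/\ fpoly p, negs (f - p) &
  forall M, negs (vx ord0 ^+ M * sigma (f - p))].
Proof.
pose P f := exists p, [/\ fpoly p, negs (f - p) &
  forall M, negs (vx ord0 ^+ M * sigma (f - p))].
have sN := negs_subgroup; have sf := fpoly_subgroup.
have sP : subgroup P.
  split=> [|f1 f2 [p1 [a1 b1 c1]] [p2 [a2 b2 c2]]].
    exists 0; split=> [||M]; rewrite ?subr0 ?rmorph0 ?mulr0; [exact: sf.1 | exact: sN.1 ..].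
  have e : f1 - f2 - (p1 - p2) = (f1 - p1) - (f2 - p2) by ring.
  exists (p1 - p2); rewrite e; split=> [||M]; [exact: sf.2 | exact: sN.2 |].
  by rewrite rmorphB mulrBr; apply: sN.2.
apply: (mspan_sub (P := P) sP); apply: (@mono_span n F (fun i => i.+1 < n)%N _ _ sP).
- move=> i f' hi_ [p [a b c]]; exists (dem i p); rewrite -raddfB.
  split; [exact: fpoly_dem | exact: negs_dem | move=> M].
  rewrite (@sigma_dem i (Ordinal hi_)) // -demM_sym; first exact: negs_dem.
  by rewrite rmorphXn S_other.
- by move=> i al /ord_max_neq[h1 h2] h _; rewrite /lastzero tnth_sact sperm_other.
- move=> i al /ord_max_neq[h1 h2] h _; rewrite /lastzero tnth_wstep tnth_sact.
  by rewrite sperm_other // (negbTE h1) (negbTE h2) addr0.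
move=> al hl dom; have [nn|neg] := boolP (wnonneg al).
  exists (mono al); rewrite subrr; split=> [||M]; first exact: mspan_gen.
    exact: sN.1.
  by rewrite rmorph0 mulr0; exact: sN.1.
(* A negative entry propagates to the right up to the last entry but one. Followed by a zero, it
   makes the tail starting there negative; after the shift it is the last entry. *)
have [i0 [e0 h0]] : exists i0 : 'I_n, i0.+1 = n /\ al`[lo i0] < 0.
  move: neg; rewrite /wnonneg => /allPn[_ /tnthP[k ->]]; rewrite -ltNge.
  have [m] := ubnP (n - k)%N; elim: m k => // m IH k hm hk.
  have kn : (k < n)%N.
    rewrite ltn_neqAle -ltnS ltn_ord andbT; apply/eqP => e.
    by move: hk; rewrite (_ : k = ord_max) ?hl ?ltxx //; apply: val_inj.
  pose i := Ordinal kn; have ek : lo i = k by apply: val_inj.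
  have [e|ne] := eqVneq k.+1 n; first by exists i; rewrite ek.
  apply: (IH (hi i)); first by rewrite /= /bump /=; lia.
  by apply: le_lt_trans hk; rewrite -ek; apply: dom => /=; lia.
have e1 : hi i0 = ord_max by apply: val_inj; rewrite /= /bump; lia.
exists 0; rewrite subr0; split=> [||M]; first exact: sf.1.
  apply: (@negs_tail i0); rewrite /tail (bigD1 (lo i0)) //= (bigD1 (hi i0)) /=; last first.
    by rewrite /bump hi_lo; lia.
  rewrite big1 ?e1 ?hl ?addr0 // => k /andP[/andP[k1 k2] k3].
  have := ltn_ord k; move: k2 k3; rewrite -!val_eqE /=; lia.
rewrite permf_mono exprnP -mono_unit -monoD; apply: (@negs_tail n).
rewrite tail_last tnth_wadd tnth_wunit tnth_mktuple -e1 cycV_hi.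
by rewrite -val_eqE /= add0r.
Qed.

End Truncation.

(** * Longest elements of the 0-Hecke monoid *)

Section HeckeNormalForm.
Variable n : nat.
Implicit Types (al be : weight n) (u v : seq nat).
Local Open Scope nat_scope.

(* Words in the generators are lists of numbers; letters that are not < n are dropped. *)
Definition toW u : seq 'I_n := pmap insub u.
Definition heq u v : Prop := hecke_eq (toW u) (toW v).

Lemma toW_cat u v : toW (u ++ v) = toW u ++ toW v.
Proof. exact: pmap_cat. Qed.

Lemma toW_cons (i : 'I_n) u : toW (val i :: u) = i :: toW u.
Proof. by rewrite /toW /= valK. Qed.

Lemma toW_map (w : seq 'I_n) : toW [seq val i | i <- w] = w.
Proof. by elim: w => // i w IH; rewrite map_cons toW_cons IH. Qed.

Lemma heq_trans u v w : heq u v -> heq v w -> heq u w.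
Proof. exact: HeckeTrans. Qed.

Lemma heq_cat u u' v v' : heq u u' -> heq v v' -> heq (u ++ v) (u' ++ v').
Proof. by rewrite /heq !toW_cat; exact: HeckeCat. Qed.

Lemma heq_refl u : heq u u. Proof. exact: HeckeRefl. Qed.

Lemma heq_cons r u v : heq u v -> heq (r :: u) (r :: v).
Proof. by move=> h; rewrite -(cat1s r u) -(cat1s r v); apply: heq_cat => //; exact: heq_refl. Qed.

Lemma heq_idem r : heq [:: r; r] [:: r].
Proof.
rewrite /heq /toW /=; case: insubP => [i _ _|_] /=; last exact: HeckeRefl.
exact: HeckeIdem.
Qed.

Lemma heq_comm r t : r.+1 < t \/ t.+1 < r -> heq [:: r; t] [:: t; r].
Proof.
rewrite /heq /toW /=; case: insubP => [i _ <-|_]; case: insubP => [j _ <-|_] //=;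
  try by move=> _; exact: HeckeRefl.
by case=> h; [exact: HeckeComm | apply: HeckeSym; exact: HeckeComm].
Qed.

Lemma heq_braid r : heq [:: r.+1; r; r.+1] [:: r; r.+1; r].
Proof.
have [h|h] := ltnP r.+1 n.
  have h' : r < n by lia.
  rewrite (_ : r = val (Ordinal h')) // -[r.+1]/(val (Ordinal h)) /heq !toW_cons.
  by apply: HeckeSym; apply: HeckeBraid.
rewrite /heq /toW /= [insub r.+1]insubF ?ltnNge ?h //=.
by apply: HeckeSym; exact: heq_idem.
Qed.

Lemma heq_move r u : all (fun t => (r.+1 < t) || (t.+1 < r)) u ->
  heq (r :: u) (u ++ [:: r]).
Proof.
elim: u => [|t u IH] /=; first by move=> _; exact: heq_refl.
case/andP=> /orP ht /IH hu; apply: (heq_trans (v := [:: t, r & u])).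
  exact: (heq_cat (heq_comm ht) (heq_refl u)).
exact: heq_cons.
Qed.

Definition within p d u := all (fun t => p <= t < p + d) u.

(** The block [s, ..., p+d] is a coset representative for the smaller parabolic. A new letter [r]
    commutes past it if [r+1 < s], lengthens it if [r+1 = s], is absorbed if [r = s], and otherwise
    crosses it by a braid move, emerging as [r-1]. *)
Lemma nf_step p d r m v : p <= r <= p + d -> m <= d.+1 -> within p d v ->
  exists m' v', [/\ m' <= d.+1, within p d v' &
    heq (r :: iota (p + d.+1 - m) m ++ v) (iota (p + d.+1 - m') m' ++ v')].
Proof.
move=> hr hm hv; set s := p + d.+1 - m.
have [lt|ge] := ltnP r.+1 s.
  exists m, (r :: v); split=> //; first by rewrite /within /= -/(within _ _ _) hv; lia.
  rewrite -cat1s catA -[in X in heq _ X]cat1s [in X in heq _ X]catA.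
  apply: heq_cat; last exact: heq_refl.
  by apply: heq_move; apply/allP => t; rewrite mem_iota; lia.
have [e|ne] := eqVneq r.+1 s.
  exists m.+1, v; split=> //; first by lia.
  have -> : p + d.+1 - m.+1 = r by lia.
  by rewrite /= e; exact: heq_refl.
have m0 : 0 < m by lia.
have [e|ne2] := eqVneq r s.
  exists m, v; split=> //.
  rewrite -/s e -(prednK m0) /=.
  exact: (heq_cat (heq_idem s) (heq_refl _)).
have e1 : iota s m = iota s (r.-1 - s) ++ [:: r.-1; r] ++ iota r.+1 (p + d - r).
  have -> : m = (r.-1 - s) + (2 + (p + d - r)) by lia.
  rewrite !iotaD; congr (_ ++ (_ ++ _)); last by congr iota; lia.
  by rewrite /=; congr [:: _; _]; lia.
exists m, (r.-1 :: v); split=> //.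
  by rewrite /within /= -/(within _ _ _) hv; lia.
rewrite -/s e1; set u1 := iota s _; set u3 := iota r.+1 _.
have h1 : heq (r :: u1) (u1 ++ [:: r]).
  by apply: heq_move; apply/allP => t; rewrite mem_iota; lia.
have h3 : heq (r.-1 :: u3) (u3 ++ [:: r.-1]).
  by apply: heq_move; apply/allP => t; rewrite mem_iota; lia.
have h2 : heq [:: r; r.-1; r] [:: r.-1; r; r.-1].
  by have := heq_braid r.-1; rewrite prednK //; lia.
apply: (heq_trans (v := (u1 ++ [:: r]) ++ ([:: r.-1; r] ++ u3 ++ v))).
  have -> : r :: (u1 ++ [:: r.-1; r] ++ u3) ++ v = (r :: u1) ++ ([:: r.-1; r] ++ u3 ++ v).
    by rewrite cat_cons -!catA.
  by apply: heq_cat => //; exact: heq_refl.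
apply: (heq_trans (v := u1 ++ [:: r.-1; r; r.-1] ++ (u3 ++ v))).
  by rewrite -catA; apply: heq_cat; [exact: heq_refl | exact: (heq_cat h2 (heq_refl _))].
rewrite -!catA; apply: heq_cat; first exact: heq_refl.
apply: (heq_cat (heq_refl [:: r.-1; r])).
by rewrite -(cat1s r.-1 v) catA -cat_cons; apply: heq_cat => //; exact: heq_refl.
Qed.

Lemma nf_ex p d u : within p d.+1 u -> exists m v,
  [/\ m <= d.+1, within p d v & heq u (iota (p + d.+1 - m) m ++ v)].
Proof.
elim: u => [|r u IH] /=; first by exists 0, [::]; split=> //; exact: heq_refl.
case/andP=> hr /IH[m [v [hm hv e]]].
have [|m' [v' [hm' hv' e']]] := @nf_step p d r m v _ hm hv; first by lia.
by exists m', v'; split=> //; apply: heq_trans e'; exact: heq_cons.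
Qed.

(** The staircase word [s_p ... s_{p+d-1}], then [s_p ... s_{p+d-2}], down to [s_p]: a reduced word
    of the longest element on [d] consecutive generators. *)
Fixpoint zword p d : seq nat := if d is d'.+1 then iota p d ++ zword p d' else [::].

Lemma zwordS p d : zword p d.+1 = iota p d.+1 ++ zword p d.
Proof. by []. Qed.

Lemma zword_within p d : within p d (zword p d).
Proof.
elim: d => // d IH; rewrite zwordS /within all_cat.
apply/andP; split.
  by apply/allP => t; rewrite mem_iota; lia.
by apply: sub_all IH => t; lia.
Qed.

(** Each block of the normal form is a final piece of the corresponding block of the staircase, so
    the full size forces every block to be complete. *)
Lemma nf_word p d u : within p d u -> exists u', [/\ heq u u',
  size u' <= size (zword p d) & size u' = size (zword p d) -> u' = zword p d].
Proof.
elim: d u => [|d IH] u hu.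
  exists [::]; split=> //; case: u hu => [|r u] /=; first by move=> _; exact: heq_refl.
  by rewrite addn0; case: ltngtP.
have [m [v [hm hv e]]] := nf_ex hu; have [v' [e' le eq]] := IH v hv.
exists (iota (p + d.+1 - m) m ++ v'); split.
- by apply: heq_trans e _; apply: heq_cat => //; exact: heq_refl.
- by rewrite zwordS !size_cat !size_iota; lia.
rewrite zwordS !size_cat !size_iota => es.
have em : m = d.+1 by lia.
by rewrite em addnK eq //; lia.
Qed.

Local Notation nthw al k := (nth (0 : int) (tval al) k).

Lemma hact1_nth (i : 'I_n) al k : nthw (hact1 i al) k =
  if k == i then Num.min (nthw al i) (nthw al i.+1) else
  if k == i.+1 then Num.max (nthw al i) (nthw al i.+1) else nthw al k.
Proof.
have := hact1E i al; have [h|h] := ltnP k n.+1.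
  by move=> /(_ (Ordinal h)); rewrite !(tnth_nth 0%R) -!val_eqE.
move=> _; rewrite [LHS]nth_default ?size_tuple //.
have iN := ltn_ord i; rewrite !ifF; [by rewrite nth_default ?size_tuple | apply/eqP; lia ..].
Qed.

Lemma hact_range p d u al : within p d u ->
  (forall k, ~~ (p <= k <= p + d) -> nthw (hact_word (toW u) al) k = nthw al k) /\
  (forall c : int, (forall k, p <= k <= p + d -> (c < nthw al k)%R) ->
    forall k, p <= k <= p + d -> (c < nthw (hact_word (toW u) al) k)%R).
Proof.
elim: u => [|r u IH] //= /andP[hr /IH[h1 h2]].
rewrite {1 2}/toW /=; case: insubP => //= i _ ei; split=> [k hk|c hc k hk].
  rewrite hact1_nth; move: ei => /= ei.
  case: ifP => [/eqP e|_]; first by exfalso; lia.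
  by case: ifP => [/eqP e|_]; [exfalso; lia | exact: h1].
move: ei => /= ei; rewrite hact1_nth; case: ifP => _.
  by rewrite lt_min !h2 //; lia.
case: ifP => _; last exact: h2.
by rewrite lt_max !h2 //; lia.
Qed.

Lemma mu_desc (i : 'I_n) al : (nthw al i.+1 < nthw al i)%R -> mu (hact1 i al) = (mu al).+1.
Proof.
move=> h; have h' : (tnth al (hi i) < tnth al (lo i))%R by rewrite !(tnth_nth 0%R).
rewrite /hact1 ltW //.
have := @mu_asc n i (sact i al); rewrite sactK !tnth_sact sperm_lo sperm_hi.
exact.
Qed.

(** The word carries entry [q] leftwards over [m] larger entries, and every exchange removes a
    strict descent. *)
Lemma mu_iota q m al : m <= q -> q <= n ->
  (forall k, q - m <= k < q -> (nthw al q < nthw al k)%R) ->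
  let be := hact_word (toW (iota (q - m) m)) al in
  [/\ mu be = mu al + m, nthw be (q - m) = nthw al q &
      forall k, k < q - m -> nthw be k = nthw al k].
Proof.
move=> mq qn; elim: m mq => [|m IH] mq h /=.
  by rewrite subn0 addn0; split.
have [|k hk|] := IH _; [lia | by apply: h; lia | ].
have e : (q - m.+1).+1 = q - m by lia.
rewrite -e; set be := hact_word _ al => h1 h2 h3.
rewrite /toW /=; case: insubP => [i _ ei|]; last by lia.
rewrite /= -/(toW _) -/be.
have hi0 : nthw be i = nthw al (q - m.+1) by rewrite ei h3 //; lia.
have hi1 : nthw be i.+1 = nthw al q by rewrite ei h2.
have lt : (nthw be i.+1 < nthw be i)%R by rewrite hi0 hi1; apply: h; lia.
split.
- by rewrite mu_desc // h1; lia.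
- by rewrite hact1_nth -ei eqxx hi1 min_r // -hi1 ltW.
move=> k hk; rewrite hact1_nth (h3 k); last lia.
move: ei => /= ei; case: ifP => [/eqP e'|_]; first by exfalso; lia.
by case: ifP => [/eqP e'|_]; first by exfalso; lia.
Qed.

(** On a strictly decreasing stretch every letter of the staircase acts nontrivially. This shows
    that the word is reduced. *)
Lemma mu_zword p d al : p + d <= n ->
  (forall k, p <= k < p + d -> (nthw al k.+1 < nthw al k)%R) ->
  mu (hact_word (toW (zword p d)) al) = mu al + size (zword p d).
Proof.
elim: d => [|d IH] hn h; first by rewrite /= addn0.
rewrite zwordS toW_cat hact_word_cat size_cat size_iota.
set be := hact_word (toW (zword p d)) al.
have mub : mu be = mu al + size (zword p d) by apply: IH => [|k hk]; [lia | apply: h; lia].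
have [out ins] := hact_range al (zword_within p d).
have qlt k : p <= k <= p + d -> (nthw al (p + d.+1) < nthw al k)%R.
  move=> hk; rewrite addnS.
  have [m em] : exists m, p + d = k + m by exists (p + d - k); lia.
  rewrite em; elim: m em => [|m IHm] em; first by rewrite addn0; apply: h; lia.
  have : (nthw al (k + m.+1).+1 < nthw al (k + m.+1))%R by apply: h; lia.
  move/lt_trans; apply; rewrite addnS.
  have : forall m', m' <= m -> (nthw al (k + m').+1 < nthw al k)%R; last by apply.
  elim=> [|m' IH'] hm'; first by rewrite addn0; apply: h; lia.
  have : (nthw al (k + m'.+1).+1 < nthw al (k + m'.+1))%R by apply: h; lia.
  by move/lt_trans; apply; rewrite addnS; apply: IH'; lia.
have [] := @mu_iota (p + d.+1) d.+1 be.
- by lia.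
- by [].
- move=> k hk; rewrite /be out; last lia.
  by apply: ins => [k' hk'|]; [exact: qlt | lia].
rewrite addnK => -> _ _; rewrite mub; lia.
Qed.

Lemma mu_hact_word (w : seq 'I_n) al : mu (hact_word w al) <= mu al + size w.
Proof.
elim: w => [|i w IH] /=; first by rewrite addn0.
by have /andP[_] := mu_hact1 i (hact_word w al); lia.
Qed.

Definition rho : weight n := [tuple (n - k)%:Z | k < n.+1].

Lemma mu_zword_rho p d : p + d <= n ->
  mu (hact_word (toW (zword p d)) rho) = mu rho + size (zword p d).
Proof.
move=> h; apply: mu_zword => // k hk.
have h1 : k < n.+1 by lia.
have h2 : k.+1 < n.+1 by lia.
rewrite -[k]/(val (Ordinal h1)) -[(val _).+1]/(val (Ordinal h2)) -!tnth_nth.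
by rewrite !tnth_mktuple /=; lia.
Qed.

Lemma heq_size_zword p d u : p + d <= n -> heq u (zword p d) ->
  size (zword p d) <= size (toW u).
Proof.
move=> h e; have := mu_hact_word (toW u) rho.
by rewrite (hact_word_eq _ e) mu_zword_rho //; lia.
Qed.

Lemma size_toW u : size (toW u) <= size u.
Proof. by rewrite /toW size_pmap; exact: count_size. Qed.

(** The extra letter cannot lower [mu] on [rho], so the normal form of the product has full size and
    is the staircase again. *)
Lemma zword_absorb p d r : p + d <= n -> p <= r < p + d ->
  heq (r :: zword p d) (zword p d).
Proof.
move=> h hr; have [|u' [e le eq]] := @nf_word p d (r :: zword p d).
  by rewrite /within /= hr; exact: zword_within.
suff : size u' = size (zword p d) by move/eq => eu; rewrite eu in e.
apply/eqP; rewrite eqn_leq le /=.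
have := mu_hact_word (toW u') rho; rewrite -(hact_word_eq _ e).
have rn : r < n by lia.
rewrite -[r]/(val (Ordinal rn)) toW_cons /=.
have := mu_hact1 (Ordinal rn) (hact_word (toW (zword p d)) rho).
by rewrite mu_zword_rho //; have := size_toW u'; lia.
Qed.

Lemma hlen_le (w : seq 'I_n) : hlen (helt w) <= size w.
Proof.
rewrite /hlen; case: ex_minnP => m _; apply.
by apply/Defs.decP; exists w.
Qed.

Lemma hlen_ex (x : hecke n) : exists2 w, size w = hlen x & helt w = x.
Proof.
rewrite /hlen; case: ex_minnP => m /Defs.decP[w [h1 h2]] _.
by exists w.
Qed.

Lemma hlen_zword p d : p + d <= n -> size (zword p d) <= hlen (helt (toW (zword p d))).
Proof.
move=> h; have [w <- e] := hlen_ex (helt (toW (zword p d))).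
have := @heq_size_zword p d [seq val i | i <- w] h.
by rewrite /heq toW_map; apply; exact: helt_eqP.
Qed.

(** The staircase witnesses that a longest element exists. Whatever [epsilon] selects has at least
    that length, so its normal form is the staircase too. *)
Lemma w0E i j p d : p + d <= n ->
  (forall k : 'I_n, (i <= k.+1 < j) = (p <= k < p + d)) ->
  w0 n i j = helt (toW (zword p d)).
Proof.
move=> h hij; set z := helt _.
have nf x : hsub i j x -> exists u', [/\ helt (toW u') = x,
    size u' <= size (zword p d) & size u' = size (zword p d) -> u' = zword p d].
  case=> w [hw <-]; have [|u' [e le eq]] := @nf_word p d [seq val i | i <- w].
    by rewrite /within all_map; apply: sub_all hw => k /=; rewrite hij.
  by exists u'; split=> //; apply: helt_eq; apply: HeckeSym; move: e; rewrite /heq toW_map.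
have zlong : is_longest i j z.
  split.
    exists (toW (zword p d)); split=> //; apply/allP => k.
    rewrite mem_pmap_sub => kz; rewrite hij.
    by have /allP := zword_within p d; apply.
  move=> x /nf[u' [<- le _]]; apply: leq_trans (hlen_le _) _.
  apply: leq_trans (size_toW u') _; apply: leq_trans le _; exact: hlen_zword.
have [] := epsilon_spec (inhabits (helt [::])) (is_longest i j) (ex_intro _ z zlong).
rewrite -/(w0 n i j) => /nf[u' [<- le eq]] /(_ z zlong.1) hz.
suff -> : u' = zword p d by [].
apply: eq; apply/eqP; rewrite eqn_leq le /=.
have := hlen_zword h; have := hlen_le (toW u'); have := size_toW u'; rewrite -/z; lia.
Qed.

End HeckeNormalForm.

(** * Expansion in the last variable *)

Section Series.
Variable R : comNzRingType.
Implicit Types f g h : nat -> R.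

Definition sone : nat -> R := fun k => (k == 0%N)%:R.
Definition smul f g : nat -> R := fun k => \sum_(i < k.+1) f i * g (k - i)%N.
Definition sgeom (u : R) : nat -> R := fun k => u ^+ k.

Lemma smul_poly f g k : smul f g k = ((\poly_(i < k.+1) f i) * \poly_(i < k.+1) g i)`_k.
Proof.
rewrite coefM; apply: eq_bigr => i _.
by rewrite !coef_poly ltn_ord ltnS leq_subr.
Qed.

(** Truncating power series to polynomials gives the laws of [smul] from those of polynomial
    multiplication. *)
Lemma smul_polyW f g k m : (k <= m)%N ->
  smul f g k = ((\poly_(i < m.+1) f i) * \poly_(i < m.+1) g i)`_k.
Proof.
move=> km; rewrite coefM; apply: eq_bigr => i _; have := ltn_ord i => ik.
by rewrite !coef_poly !ifT //; lia.
Qed.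

Fact smulA : associative smul.
Proof.
move=> f g h; apply: functional_extensionality => k.
pose P f := \poly_(i < k.+1) f i.
have E f1 g1 : \poly_(i < k.+1) smul f1 g1 i = \poly_(i < k.+1) (P f1 * P g1)`_i.
  by apply: eq_poly => i ik; rewrite (@smul_polyW _ _ _ k) //; lia.
have take (p q : {poly R}) : ((\poly_(i < k.+1) p`_i) * q)`_k = (p * q)`_k.
  by rewrite !coefM; apply: eq_bigr => i _; rewrite coef_poly ltn_ord.
rewrite !smul_poly !E take -/(P f) -/(P h).
by rewrite [P f * _]mulrC take [_ * P f]mulrC mulrA.
Qed.

Fact smulC : commutative smul.
Proof.
by move=> f g; apply: functional_extensionality => k; rewrite !smul_poly mulrC.
Qed.

Fact smul1l : left_id sone smul.
Proof.
move=> f; apply: functional_extensionality => k.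
rewrite /smul big_ord_recl subn0 mul1r big1 ?addr0 // => i _.
by rewrite /sone mul0r.
Qed.

HB.instance Definition _ :=
  Monoid.isComLaw.Build (nat -> R) sone smul smulA smulC smul1l.

Lemma smul_geomS u f k : smul (sgeom u) f k.+1 = f k.+1 + u * smul (sgeom u) f k.
Proof.
rewrite /smul big_ord_recl /sgeom expr0 mul1r subn0; congr (_ + _).
by rewrite mulr_sumr; apply: eq_bigr => i _; rewrite mulrA -exprS.
Qed.

Lemma smul_geom0 u f : smul (sgeom u) f 0 = f 0%N.
Proof. by rewrite /smul big_ord1 mul1r. Qed.

(** The coefficient of [q^k] is a sum of products of [k] factors [u i], so it inherits any graded
    property of the factors. *)
Lemma graded_big (I : Type) (r : seq I) (Q : pred I) (u : I -> R) (D : nat -> R -> Prop) :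
  (forall k, subgroup (D k)) -> D 0%N 1 ->
  (forall i j (x y : R), D i x -> D j y -> D (i + j)%N (x * y)) ->
  (forall i, Q i -> D 1%N (u i)) ->
  forall k, D k ((\big[smul/sone]_(i <- r | Q i) sgeom (u i)) k).
Proof.
move=> sD D1 DM Du; elim/big_ind: _ => [k|f g hf hg k|i Qi k].
- by rewrite /sone; case: k => [|k]; [exact: D1 | exact: (sD _).1].
- apply: subgroup_sum => // i _; rewrite -{1}(subnKC (leq_ord i)); exact: DM.
elim: k => [|k IH]; first by rewrite /sgeom expr0.
by rewrite /sgeom exprS -add1n; apply: DM => //; apply: Du.
Qed.

Lemma scale_big (I : Type) (r : seq I) (Q : pred I) (u : I -> R) (c : R) k :
  (\big[smul/sone]_(i <- r | Q i) sgeom (c * u i)) k =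
  c ^+ k * (\big[smul/sone]_(i <- r | Q i) sgeom (u i)) k.
Proof.
pose E (f g : nat -> R) := forall k, f k = c ^+ k * g k.
suff : E (\big[smul/sone]_(i <- r | Q i) sgeom (c * u i))
         (\big[smul/sone]_(i <- r | Q i) sgeom (u i)) by apply.
apply: (big_ind2 E) => [k'|f f' g g' hf hg k'|i _ k'].
- by rewrite /sone; case: k' => [|k']; rewrite ?mulr1 ?mulr0.
- rewrite /smul mulr_sumr; apply: eq_bigr => i _; rewrite hf hg.
  have -> : c ^+ k' = c ^+ i * c ^+ (k' - i) by rewrite -exprD subnKC // leq_ord.
  ring.
- by rewrite /sgeom exprMn.
Qed.

End Series.

Lemma morph_big (R T : comNzRingType) (phi : {rmorphism R -> T}) (I : Type)
    (r : seq I) (Q : pred I) (u : I -> R) k :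
  phi ((\big[@smul R/sone R]_(i <- r | Q i) sgeom (u i)) k) =
  (\big[@smul T/sone T]_(i <- r | Q i) sgeom (phi (u i))) k.
Proof.
pose E (f : nat -> R) (g : nat -> T) := forall k, phi (f k) = g k.
suff : E (\big[@smul R/sone R]_(i <- r | Q i) sgeom (u i))
         (\big[@smul T/sone T]_(i <- r | Q i) sgeom (phi (u i))) by apply.
apply: (big_ind2 E) => [k'|f f' g g' hf hg k'|i _ k'].
- by rewrite /sone rmorph_nat.
- by rewrite /smul rmorph_sum; apply: eq_bigr => i _; rewrite rmorphM hf hg.
- by rewrite /sgeom rmorphXn.
Qed.

(** * Truncation and the coefficients of the last variable *)

Section Core.
Variables (n : nat) (F : symField n).
Implicit Types (al be ga : weight n) (i j : 'I_n) (k : nat) (f g : F).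
Local Notation "al `[ k ]" := (tnth al k) (at level 2, format "al `[ k ]").
Local Notation mono := (mono F).
Local Notation dem := (@dem n F).
Local Notation mspan := (@mspan n F).
Local Notation kap := (@kap n F).
Local Notation vx := (vx F).
Local Notation negs := (@negs n F).
Local Notation fpoly := (@fpoly n F).
Local Notation lastzero := (@lastzero n).
Local Notation sigma := (sf_perm F (cyc n)).
Local Notation S_ i := (sf_perm F (sperm i)).
Local Notation tw := (@toW n).

Lemma mspanM (C D E : weight n -> Prop) f g :
  (forall al be, C al -> D be -> E (wadd al be)) ->
  mspan C f -> mspan D g -> mspan E (f * g).
Proof.
move=> H hf hg; have sE : subgroup (mspan E) by exact: mspan_subgroup.
move: f hf; apply: mspan_sub.
  by split=> [|f1 f2 h1 h2]; rewrite ?mul0r ?mulrBl; [exact: sE.1 | exact: sE.2].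
move=> al Ca; move: g hg; apply: mspan_sub.
  by split=> [|f1 f2 h1 h2]; rewrite ?mulr0 ?mulrBr; [exact: sE.1 | exact: sE.2].
by move=> be Db; rewrite -monoD; apply: mspan_gen; exact: H.
Qed.

(** Passes from the inductive span to finitely supported coefficients, the format in which [keycoef]
    chooses. *)
Lemma kap_fsfun (C : weight n -> Prop) f :
  zspan (fun g => exists2 al, C al & g = kap al) f ->
  exists2 c : {fsfun weight n -> int with 0}, (forall al, al \in finsupp c -> C al) &
    f = \sum_(al <- finsupp c) kap al *~ c al.
Proof.
have ext (c : {fsfun weight n -> int with 0}) (A : {fset weight n}) :
    (finsupp c `<=` A)%fset ->
    \sum_(al <- finsupp c) kap al *~ c al = \sum_(al <- A) kap al *~ c al.
  move=> sub; rewrite (big_fset_incl _ sub) // => al _ ; rewrite memNfinsupp => /eqP ->.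
  by rewrite mulr0z.
have step (c : {fsfun weight n -> int with 0}) be (e : int) :
    (forall al, al \in finsupp c -> C al) -> C be ->
    exists2 c' : {fsfun weight n -> int with 0}, (forall al, al \in finsupp c' -> C al) &
    \sum_(al <- finsupp c) kap al *~ c al + kap be *~ e =
    \sum_(al <- finsupp c') kap al *~ c' al.
  move=> hc Cb; pose A := (be |` finsupp c)%fset.
  pose c' := [fsfun al in A => c al + (if al == be then e else 0)] : {fsfun weight n -> int with 0}.
  have sA : (finsupp c' `<=` A)%fset by exact: finsupp_sub.
  have sA' : (finsupp c `<=` A)%fset by exact: fsubsetUr.
  exists c'.
    by move=> al /(fsubsetP sA); rewrite in_fset1U => /orP[/eqP ->|/hc].
  rewrite (ext c A) // (ext c' A) //.
  have bA : be \in A by rewrite in_fset1U eqxx.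
  rewrite !(big_fsetD1 be bA) /= fsfunE bA eqxx mulrzDr addrAC; congr (_ + _).
  apply: eq_big_seq => al; rewrite in_fsetD1 => /andP[/negbTE nb aA].
  by rewrite fsfunE aA nb addr0.
elim=> {f} [|f g [be Cb ->] _ [c hc ->]|f g [be Cb ->] _ [c hc ->]].
- exists [fsfun] => [al|]; first by rewrite finsupp0.
  by rewrite finsupp0 big_seq_fset0.
- by have [c' h e] := step c be 1 hc Cb; exists c'; rewrite // -e mulr1z addrC.
- by have [c' h e] := step c be (-1) hc Cb; exists c'; rewrite // -e mulrNz mulr1z.
Qed.

Lemma kap_fsfun_inj (c c' : {fsfun weight n -> int with 0}) :
  \sum_(al <- finsupp c) kap al *~ c al = \sum_(al <- finsupp c') kap al *~ c' al ->
  c = c'.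
Proof.
pose A := (finsupp c `|` finsupp c')%fset.
have ext (d : {fsfun weight n -> int with 0}) : (finsupp d `<=` A)%fset ->
    \sum_(al <- finsupp d) kap al *~ d al = \sum_(al <- A) kap al *~ d al.
  move=> sub; rewrite (big_fset_incl _ sub) // => al _ ; rewrite memNfinsupp => /eqP ->.
  by rewrite mulr0z.
rewrite (ext c (fsubsetUl _ _)) (ext c' (fsubsetUr _ _)) => e.
have := @kap_indep n F A (fun al => c al - c' al) (fset_uniq A).
have -> : \sum_(al <- A) kap al *~ (c al - c' al) = 0.
  by under eq_bigr do rewrite mulrzBr; rewrite sumrB e subrr.
move=> /(_ erefl) h; apply/fsfunP => al.
have [aA|] := boolP (al \in A); first by apply/eqP; rewrite -subr_eq0 h.
by rewrite in_fsetU negb_or !memNfinsupp => /andP[/eqP -> /eqP ->].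
Qed.

Lemma kap_pos_negs0 f :
  zspan (fun g => exists2 al, wnonneg al & g = kap al) f -> negs f -> f = 0.
Proof.
move=> /(kap_fsfun (C := fun al => wnonneg al))[c hc ->].
move=> /(kap_fsfun (C := fun al => ~~ wnonneg al))[c' hc' /kap_fsfun_inj e].
rewrite big_seq big1 // => al ac; have := hc' al; rewrite -e => /(_ ac).
by rewrite hc.
Qed.

Lemma pos_negs0 f : mspan (fun al => wnonneg al) f -> negs f -> f = 0.
Proof. by move/polys_kap; exact: kap_pos_negs0. Qed.

(** Two decompositions of one element differ by [P - p = g - N], which lies both in the polynomials
    and in [negs], hence is zero. *)
Lemma keysum_pos (c : {fsfun weight n -> int with 0}) p g :
  \sum_(al <- finsupp c) kap al *~ c al = p + g ->
  mspan (fun al => wnonneg al) p -> negs g ->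
  \sum_(al <- finsupp c | wnonneg al) kap al *~ c al = p.
Proof.
rewrite (bigID (@wnonneg n)) /=; set P := (X in X + _ = _); set N := (X in _ + X = _).
move=> e hp hg; have sZ := @zspan_subgroup F (fun g => exists2 al, wnonneg al & g = kap al).
have sN := @negs_subgroup n F.
apply/eqP; rewrite -subr_eq0; apply/eqP; apply: kap_pos_negs0.
  apply: sZ.2; last exact: polys_kap.
  by apply: subgroup_sum => // al h; apply: subgroupMz => //; apply: zspan_gen; exists al.
have -> : P - p = g - N by rewrite -[P](addrK N) e; ring.
apply: sN.2 => //; apply: subgroup_sum => // al h; apply: subgroupMz => //.
by apply: zspan_gen; exists al.
Qed.

Lemma keysum_ex p g : mspan (fun al => wnonneg al) p -> negs g ->
  exists c : {fsfun weight n -> int with 0},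
    \sum_(al <- finsupp c) kap al *~ c al = p + g.
Proof.
move=> hp hg; have : zspan (fun g => exists2 al, True & g = kap al) (p + g).
  apply: subgroupD; first exact: zspan_subgroup.
    by apply: zspan_mono (polys_kap hp) => _ [al _ ->]; exists al.
  by apply: zspan_mono hg => _ [al _ ->]; exists al.
by move/(kap_fsfun (C := fun=> True)) => [c _ ->]; exists c.
Qed.

Lemma fpoly_pos f : fpoly f -> mspan (fun al => wnonneg al) f.
Proof. by apply: mspan_mono => al []. Qed.

(* [hh A B k] is the complete homogeneous h_k(1/x_A, ..., 1/x_(B-1)). *)
Definition hh (A B : nat) : nat -> F :=
  \big[@smul F/sone F]_(j < n.+1 | (A <= j < B)%N) sgeom (vx j)^-1.

Lemma hh_ind (P : F -> Prop) A B k : subgroup P -> P 1 ->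
  (forall f g, P f -> P g -> P (f * g)) ->
  (forall j : 'I_n.+1, (A <= j < B)%N -> P (vx j)^-1) -> P (hh A B k).
Proof.
by move=> sP P1 PM Pv; apply: (@graded_big F _ _ _ _ (fun _ => P)) => // *; exact: PM.
Qed.

Lemma hh_negs A B k f : negs f -> negs (hh A B k * f).
Proof.
have sN := @negs_subgroup n F; move: f.
apply: (hh_ind (P := fun g => forall f, negs f -> negs (g * f))).
- split=> [f _|f1 f2 h1 h2 f hf]; rewrite ?mul0r ?mulrBl; first exact: sN.1.
  by apply: sN.2; [exact: h1 | exact: h2].
- by move=> f; rewrite mul1r.
- by move=> f g hf hg h hh; rewrite -mulrA; apply: hf; apply: hg.
- by move=> j _ f; exact: negs_vxV.
Qed.

Lemma hh_lastzero A k : mspan lastzero (hh A n k).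
Proof.
apply: hh_ind; first exact: mspan_subgroup.
- have -> : 1 = mono (wunit ord0 0) by rewrite mono_unit expr0z.
  by apply: mspan_gen; rewrite /lastzero tnth_wunit if_same.
- move=> f g; apply: mspanM => al be ha hb.
  by rewrite /lastzero tnth_wadd ha hb addr0.
- move=> j /andP[_ jn]; rewrite vxV; apply: mspan_gen.
  by rewrite /lastzero tnth_wunit ifF //; apply/negbTE; rewrite -val_eqE /=; lia.
Qed.

Lemma hh_peel (j : 'I_n.+1) B : (j < B)%N -> hh j B = smul (sgeom (vx j)^-1) (hh j.+1 B).
Proof.
move=> jB; rewrite /hh (bigD1 j) /=; last by rewrite leqnn.
congr (smul _ _); apply: eq_bigl => j'; rewrite -val_eqE /=; lia.
Qed.

Lemma hh_nil A B : (B <= A)%N -> hh A B = sone F.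
Proof. by move=> BA; apply: big_pred0 => j; lia. Qed.

Lemma S_hh i A B k : (A <= i)%N -> (i.+1 < B)%N -> S_ i (hh A B k) = hh A B k.
Proof.
move=> Ai iB; rewrite /hh morph_big [in RHS](reindex_inj (@perm_inj _ (sperm i))) /=.
congr (_ k); apply: eq_big => [j|j _]; last by rewrite fmorphV permf_vx.
rewrite spermE; case: eqP => [->|_]; first by rewrite /= /bump; lia.
by case: eqP => [->|_] //; rewrite /= /bump; lia.
Qed.

(** By the recursion, [h_k] in the variables after [i] is [h_k] with [1/x_i] included, minus [1/x_i]
    times a symmetric factor; and [pi_i] kills [1/x_i]. *)
Lemma dem_hh i k : (i.+1 < n)%N -> dem i (hh i.+1 n k) = hh i n k.
Proof.
move=> hi_; have e := @hh_peel (lo i) n; rewrite loE in e.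
have Sh k' : S_ i (hh i n k') = hh i n k' by apply: S_hh.
case: k => [|k].
  have h0 : hh i n 0 = hh i.+1 n 0%N by rewrite e ?smul_geom0 //; lia.
  by rewrite -h0 dem_sym.
have -> : hh i.+1 n k.+1 = hh i n k.+1 - hh i n k * (vx (lo i))^-1.
  have := smul_geomS (vx (lo i))^-1 (hh i.+1 n) k; rewrite -e; last lia.
  by move=> ->; ring.
rewrite raddfB /= dem_sym // demM_sym //.
suff -> : dem i (vx (lo i))^-1 = 0 by rewrite mulr0 subr0.
by rewrite /dem /ddiv fmorphV S_lo !mulfV ?vx_neq0 // subrr mul0r.
Qed.

Lemma toW_cons_lt (t : nat) (ht : (t < n)%N) u : tw (t :: u) = Ordinal ht :: tw u.
Proof. exact: (toW_cons (Ordinal ht)). Qed.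

(** [pk k] is the coefficient of the [k]-th power of the last variable. Asking for all large [B]
    makes almost all of them vanish and lets expansions of different polynomials be subtracted. *)
Definition last_expansion (A : nat) (w : seq nat) (p : F) : Prop :=
  exists pk : nat -> F, [/\ forall k, fpoly (pk k),
    forall k, negs (pk k - hh A n k * p) &
    exists B0, forall B, (B0 <= B)%N ->
      demw (tw w) p = \sum_(k < B) vx ord_max ^+ k * pk k].

Lemma last_expansion0 p : fpoly p -> last_expansion n [::] p.
Proof.
move=> hp; exists (fun k => if k is 0%N then p else 0); split.
- by case=> [|k] //; exact: (@fpoly_subgroup n F).1.
- move=> k; rewrite hh_nil // /sone; case: k => [|k]; rewrite ?mul1r ?mul0r subrr;
    exact: (@negs_subgroup n F).1.
exists 1%N => -[//|B] _; rewrite big_ord_recl mul1r big1 ?addr0 // => k _.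
by rewrite mulr0.
Qed.

Lemma demX i c : dem i (vx (lo i) ^+ c) =
  \sum_(k < c.+1) vx (lo i) ^+ (c - k) * vx (hi i) ^+ k.
Proof.
rewrite /dem /ddiv rmorphXn S_lo -!exprS subrXX mulrC mulKf //.
by rewrite subr_eq0 x_lo_hi.
Qed.

(** On a monomial with exponent [c] at [lo i], the operator gives the geometric sum of [demX]. For
    [k <= c] the coefficient is exactly [h_k] times the monomial; for larger [k] it is zero. *)
Lemma last_expansion1 i p : i.+1 = n -> fpoly p -> last_expansion i [:: val i] p.
Proof.
move=> ei; have ehi : hi i = ord_max by apply: val_inj; rewrite /= /bump; lia.
have sN := @negs_subgroup n F; have sf := @fpoly_subgroup n F.
have hhE k : hh i n k = (vx (lo i))^-1 ^+ k.
  have := @hh_peel (lo i) n; rewrite loE => ->; last lia.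
  by rewrite (hh_nil (A := i.+1)); [rewrite smulC smul1l | lia].
apply: (mspan_sub (P := last_expansion i [:: val i])).
  split=> [|f g [pf [a1 b1 [B1 c1]]] [pg [a2 b2 [B2 c2]]]].
    exists (fun=> 0); split=> [k|k|]; first exact: sf.1.
      by rewrite mulr0 subrr; exact: sN.1.
    exists 0%N => B _; rewrite raddf0 big1 // => k _; exact: mulr0.
  exists (fun k => pf k - pg k); split=> [k|k|]; first exact: sf.2.
    have -> : pf k - pg k - hh i n k * (f - g) =
      (pf k - hh i n k * f) - (pg k - hh i n k * g) by ring.
    exact: sN.2.
  exists (maxn B1 B2) => B; rewrite geq_max => /andP[h1 h2].
  rewrite raddfB /= (c1 B h1) (c2 B h2) -sumrB.
  by apply: eq_bigr => k _; rewrite mulrBr.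
move=> al [/wnonnegP nn last0].
have [c ec] : exists c : nat, al`[lo i] = c%:Z.
  by exists `|al`[lo i]|%N; rewrite gez0_abs.
pose be : weight n := [tuple if k == lo i then 0 else al`[k] | k < n.+1].
have eal : al = wadd (wunit (lo i) c%:Z) be.
  apply: eq_from_tnth => k; rewrite tnth_wadd tnth_wunit tnth_mktuple.
  by case: eqP => [->|_]; rewrite ?addr0 ?add0r.
have ebe : mono al = mono be * vx (lo i) ^+ c.
  by rewrite [in LHS]eal monoD mono_unit mulrC.
have Sbe : S_ i (mono be) = mono be.
  rewrite S_mono sact_id // !tnth_mktuple eqxx ehi last0.
  by case: eqP.
have eV k : (vx (lo i))^-1 ^+ k * mono al = mono (wadd al (wunit (lo i) (- k%:Z))).
  by rewrite monoD mono_unit mulrC exprVn exprnN.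
have maxlo : (ord_max == lo i) = false by rewrite -ehi hi_lo.
exists (fun k => if (k <= c)%N then (vx (lo i))^-1 ^+ k * mono al else 0); split=> [k|k|].
- case: leqP => kc; last exact: sf.1.
  rewrite eV; apply: mspan_gen; split; last by rewrite tnth_wadd tnth_wunit maxlo last0.
  apply/wnonnegP => k'; rewrite tnth_wadd tnth_wunit; have := nn k'.
  by case: eqP => [->|_]; rewrite ?ec; lia.
- rewrite hhE; case: leqP => kc; first by rewrite subrr; exact: sN.1.
  (* For [k > c] the last entry is zero and the one before it is [c - k], so a tail is negative. *)
  rewrite sub0r; apply: subgroupN => //; rewrite eV; apply: (@negs_tail _ _ i).
  rewrite tail_wadd tail_wunit leqnn /tail (bigD1 (lo i)) //= (bigD1 (hi i)) /=; last first.
    by rewrite hi_lo /bump; lia.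
  rewrite big1 ?ec ?ehi ?last0; first by lia.
  move=> k' /andP[/andP[k1 k2] k3]; have := ltn_ord k'.
  by move: k2 k3; rewrite -ehi -!val_eqE /= /bump; lia.
exists c.+1 => B cB; rewrite toW_cons /= ebe demM_sym // demX.
rewrite (big_ord_widen _ (fun k => vx (lo i) ^+ (c - k) * vx (hi i) ^+ k) cB) mulr_sumr.
rewrite big_mkcond; apply: eq_bigr => k _; rewrite ltnS; case: leqP => kc; last by rewrite mulr0.
rewrite -ehi exprVn -{2}(subnK kc) exprD.
have h0 : vx (lo i) ^+ k != 0 by rewrite expf_neq0 ?vx_neq0.
by field.
Qed.

(** Applying [pi_A] adds the variable [x_A] to [h_k] by [dem_hh]; both [p] and the powers of the
    last variable pass through it. The induction starts at one letter, since the last generator does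
    move that variable; the empty word is the case [A = n]. *)
Lemma last_expansionP d A p : (A + d = n)%N -> fpoly p ->
  (forall i, (A <= i)%N -> (i.+1 < n)%N -> S_ i p = p) ->
  last_expansion A (iota A d) p.
Proof.
elim: d A => [|d IH] A e hp Sp; first by rewrite (_ : A = n); [exact: last_expansion0 | lia].
have An : (A < n)%N by lia.
case: d IH e => [|d] IH e.
  by apply: (@last_expansion1 (Ordinal An)) => //=; lia.
have [|||pk [h1 h2 [B0 h3]]] := IH A.+1; rewrite ?addSnnS //.
  by move=> i Ai; apply: Sp; lia.
pose i := Ordinal An; have iA : (i.+1 < n)%N by rewrite /=; lia.
have Smax k : S_ i (vx ord_max ^+ k) = vx ord_max ^+ k.
  by have [m1 m2] := ord_max_neq iA; rewrite rmorphXn S_other.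
exists (fun k => dem i (pk k)); split=> [k|k|].
- exact: fpoly_dem.
- rewrite -(@dem_hh i k iA) mulrC -demM_sym; last by apply: Sp.
  by rewrite -raddfB; apply: negs_dem; rewrite mulrC; exact: h2.
exists B0 => B hB; rewrite -[iota A d.+2]/(A :: iota A.+1 d.+1) (toW_cons_lt An) /=.
rewrite -/(demw _ _) (h3 B hB) raddf_sum; apply: eq_bigr => k _ /=.
by rewrite demM_sym.
Qed.

Lemma demw_within p d u f : within p d u ->
  forall Q : F -> Prop, (forall i g, (p <= i < p + d)%N -> Q g -> Q (dem i g)) ->
  Q f -> Q (demw (tw u) f).
Proof.
move=> + Q HQ Qf; elim: u => // t u IH /andP[ht /IH h].
rewrite /toW /= -/(tw _); case: insubP => //= i _ ei.
by apply: HQ => //; rewrite ei.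
Qed.

Lemma demwM_sym p d u f g : within p d u ->
  (forall i, (p <= i < p + d)%N -> S_ i f = f) ->
  demw (tw u) (f * g) = f * demw (tw u) g.
Proof.
move=> + Sf; elim: u => // t u IH /andP[ht /IH h].
rewrite /toW /= -/(tw _); case: insubP => //= i _ ei.
by rewrite -/(demw _ _) h demM_sym // Sf // ei.
Qed.

Lemma sigma_demw p d u f : within p d u -> (p + d < n)%N ->
  sigma (demw (tw u) f) = demw (tw (map succn u)) (sigma f).
Proof.
move=> + pd; elim: u => // t u IH /andP[ht /IH h]; rewrite map_cons.
have t1 : (t < n)%N by lia.
have t2 : (t.+1 < n)%N by lia.
by rewrite (toW_cons_lt t1) (toW_cons_lt t2) /= -h; apply: sigma_dem.
Qed.

Lemma zword_succ p d : map succn (zword p d) = zword p.+1 d.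
Proof.
elim: d => // d IH; rewrite !zwordS map_cat IH; congr (_ ++ _).
by rewrite -[p.+1]add1n iotaDl.
Qed.

Lemma sigma_pos M p : fpoly p -> mspan (fun al => wnonneg al) (vx ord0 ^+ M * sigma p).
Proof.
have sP : subgroup (mspan (fun al => wnonneg al)) by exact: mspan_subgroup.
move: p; apply: mspan_sub.
  by split=> [|f g hf hg]; rewrite ?rmorph0 ?mulr0 ?rmorphB ?mulrBr; [exact: sP.1 | exact: sP.2].
move=> al [/wnonnegP nn _]; rewrite permf_mono exprnP -mono_unit -monoD.
apply: mspan_gen; apply/wnonnegP => k; rewrite tnth_wadd tnth_wunit tnth_mktuple.
by apply: addr_ge0 => //; case: eqP.
Qed.

(** For one Laurent polynomial [f] free of [x_l]: [p0] is its truncation, the [pk k] are the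
    coefficients after the full longest element, and [q] is the truncation of the shift of [h_k f]
    by which the other side of the theorem reaches the same coefficient. *)
Lemma rotation_core A f : (A <= n)%N -> mspan lastzero f ->
  exists p0 pk, [/\ fpoly p0 /\ negs (f - p0), forall k, fpoly (pk k),
    exists B0, forall B, (B0 <= B)%N ->
      demw (tw (zword A (n - A))) p0 = \sum_(k < B) vx ord_max ^+ k * pk k,
    negs f -> forall k, pk k = 0 &
    forall k M, exists q, [/\ mspan (fun al => wnonneg al) q,
      negs (vx ord0 ^+ M * sigma (hh A n k * f) - q) &
      demw (tw (zword A.+1 (n - A.+1))) q = vx ord0 ^+ M * sigma (pk k)]].
Proof.
move=> An hf; set e := (n - A.+1)%N; set Z := zword A e.
have Zin : within A e Z := zword_within A e.
have ZN g : negs g -> negs (demw (tw Z) g) by exact: negs_demw.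
have [p0 [hp0 Np0 _]] := lastzero_split hf.
pose p := demw (tw Z) p0.
have letter i : (A <= i < A + e)%N -> (i.+1 < n)%N by lia.
have Zf g : fpoly g -> fpoly (demw (tw Z) g).
  by apply: (demw_within Zin) => i h hi_ hg; apply: fpoly_dem => //; exact: letter.
have hp : fpoly p by exact: Zf.
have Sp i : (A <= i)%N -> (i.+1 < n)%N -> S_ i p = p.
  (* [p] is an image under a longest element, which absorbs every generator of its range on the
     left; hence [p] is invariant under each of them. *)
  move=> Ai iN; have ab : heq n (val i :: Z) Z by apply: zword_absorb; rewrite /e /=; lia.
  have := demw_eq p0 ab; rewrite toW_cons /= -/(demw _ _) -/p => <-.
  exact: S_dem.
have [pk [h1 h2 [B0 h3]]] : last_expansion A (iota A (n - A)) p.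
  by apply: last_expansionP => //; lia.
exists p0, pk; split=> //.
- exists B0 => B hB; rewrite -(h3 B hB) /p.
  (* For [A = n] truncated subtraction gives [e = 0], although [n - A] is not [e.+1]; all words are
     then empty. *)
  have [e0|ne] := eqVneq A n.
    by rewrite /Z /e e0 subnn (_ : (n - n.+1)%N = 0%N) //; lia.
  have -> : (n - A)%N = e.+1 by rewrite /e; lia.
  by rewrite zwordS toW_cat demw_cat.
- move=> Nf k; have sN := @negs_subgroup n F.
  have p00 : p0 = 0.
    apply: pos_negs0; first exact: fpoly_pos.
    by rewrite -[p0](subKr f); apply: sN.2.
  apply: pos_negs0; first exact: fpoly_pos.
  by have := h2 k; rewrite /p p00 raddf0 mulr0 subr0.
move=> k M.
have hkf : mspan lastzero (hh A n k * f).
  apply: mspanM (hh_lastzero A k) hf => al be ha hb.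
  by rewrite /lastzero tnth_wadd ha hb addr0.
have [q0 [hq0 Nq0 Nq1]] := lastzero_split hkf.
exists (vx ord0 ^+ M * sigma q0); split; first exact: sigma_pos.
  by rewrite -mulrBr -rmorphB; exact: Nq1.
(* Both sides are polynomials, so a congruence modulo [negs] is an equality. It is checked in three
   pieces: [pk k] against [h_k p], then [p0] replaced by [f], then [h_k f] by its truncation. The
   factor [h_k] passes through [Z] by symmetry. *)
have -> : pk k = demw (tw Z) q0.
  apply/eqP; rewrite -subr_eq0; apply/eqP; apply: pos_negs0.
    by apply: fpoly_pos; apply: (@fpoly_subgroup n F).2 => //; exact: Zf.
  have -> : pk k - demw (tw Z) q0 = (pk k - hh A n k * p)
      - hh A n k * demw (tw Z) (f - p0)
      + demw (tw Z) (hh A n k * f - q0).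
    rewrite !raddfB /= (demwM_sym f Zin).
      by rewrite -/p; ring.
    by move=> i hi_; apply: S_hh; have := letter i hi_; lia.
  have sN := @negs_subgroup n F.
  apply: subgroupD => //; last exact: ZN.
  by apply: sN.2 => //; apply: hh_negs; exact: ZN.
rewrite -zword_succ -/Z (demwM_sym _ (p := A.+1) (d := e)).
- have [e0|ne] := eqVneq A n.
    by rewrite /Z /e e0 (_ : (n - n.+1)%N = 0%N) //; lia.
  by rewrite (sigma_demw _ Zin) //; rewrite /e; lia.
- by rewrite /Z zword_succ; exact: zword_within.
by move=> i hi_; rewrite rmorphXn S_other // -val_eqE /= /bump; lia.
Qed.

End Core.

(** * Root series *)

Section RootSeries.
Variables (n : nat) (F : symField n).
Implicit Types (al be ga : weight n) (i j : 'I_n) (k : nat) (f g : F) (Psi : rootset n).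
Local Notation "al `[ k ]" := (tnth al k) (at level 2, format "al `[ k ]").
Local Notation mono := (mono F).
Local Notation mspan := (@mspan n F).
Local Notation vx := (vx F).
Local Notation negs := (@negs n F).
Local Notation lastzero := (@lastzero n).
Local Notation sigma := (sf_perm F (cyc n)).
Local Notation hh := (@hh n F).

Definition root_geom (r : 'I_n.+1 * 'I_n.+1) : nat -> F := sgeom (vx r.1 / vx r.2).
Definition rser Psi : nat -> F := \big[@smul F/sone F]_(r in Psi) root_geom r.

Lemma card_ltn m : (m <= n.+1)%N -> #|[set j : 'I_n.+1 | (j < m)%N]| = m.
Proof.
move=> mn; rewrite cardsE -sum1_card.
by rewrite -(big_ord_widen n.+1 (fun=> 1%N) mn) sum1_card card_ord.
Qed.

(** The non-roots of the first row form an initial segment, which contains the diagonal position.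
    Hence [nr1] is positive, and [A] is [a - 1] in the numbering from zero. *)
Lemma nr1P Psi : root_ideal Psi -> exists2 A, nr1 Psi = A.+1 /\ (A <= n)%N &
  forall j : 'I_n.+1, ((ord0, j) \in Psi) = (A < j)%N.
Proof.
move=> [strict up]; pose D := [set j | (ord0, j) \notin Psi].
have D0 : ord0 \in D by rewrite inE; apply/negP => /strict.
have down (j j' : 'I_n.+1) : j \in D -> (j' <= j)%N -> j' \in D.
  rewrite !inE => jD le; apply: contra jD => h.
  by apply: (up ord0 j') => //; apply: leq_trans le; exact: strict h.
have memD (j : 'I_n.+1) : (j \in D) = (j < #|D|)%N.
  have [jD|jD] := boolP (j \in D).
    symmetry; rewrite -[j.+1](card_ltn (ltn_ord j)); apply: subset_leq_card.
    by apply/subsetP => j'; rewrite inE ltnS; exact: down.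
  symmetry; apply/negbTE; rewrite -leqNgt -[X in (_ <= X)%N](card_ltn (ltnW (ltn_ord j))).
  apply: subset_leq_card; apply/subsetP => j' j'D; rewrite inE ltnNge.
  by apply: contra jD; exact: down.
have := memD ord0; rewrite D0; case E : #|D| => [|A] // _.
exists A; first split=> //.
  by have := max_card (mem D); rewrite E card_ord.
by move=> j; have := memD j; rewrite inE E ltnS leqNgt => /negbRL ->; rewrite negbK.
Qed.

Definition shift_root (r : 'I_n.+1 * 'I_n.+1) : 'I_n.+1 * 'I_n.+1 :=
  (inord r.1.-1, inord r.2.-1).
Definition lower Psi : rootset n := [set r in Psi | (0 < r.1)%N].
(** The series of [Rroots] without its last column. The shift turns it into the series of [Psi]
    without its first row. *)
Definition gser Psi : nat -> F := rser (shift_root @: lower Psi).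
Definition col_root : rootset n := [set (i, ord_max) | i : 'I_n.+1 & (i < n)%N].

Lemma RrootsE Psi : Rroots Psi = shift_root @: lower Psi :|: col_root.
Proof. by congr (_ :|: _). Qed.

Section Strict.
Variable Psi : rootset n.
Hypothesis strict : forall i j : 'I_n.+1, (i, j) \in Psi -> (i < j)%N.

Lemma lower_lt r : r \in lower Psi -> (0 < r.1 < r.2)%N.
Proof. by case: r => a b; rewrite inE /= => /andP[/strict -> ->]. Qed.

Lemma shift_rootE r : r \in lower Psi ->
  (shift_root r).1 = r.1.-1 :> nat /\ (shift_root r).2 = r.2.-1 :> nat.
Proof.
case: r => a b /lower_lt /= h; have h1 := ltn_ord a; have h2 := ltn_ord b.
by rewrite !inordK //; lia.
Qed.

Lemma shift_root_inj : {in lower Psi &, injective shift_root}.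
Proof.
move=> r r' hr hr' e; have [e1 e2] := shift_rootE hr; have [e1' e2'] := shift_rootE hr'.
have := lower_lt hr; have := lower_lt hr'; rewrite e in e1 e2 => h h'.
case: r r' e1 e2 e1' e2' h h' {hr hr' e} => [a b] [c d] /= *.
by congr pair; apply: val_inj => /=; lia.
Qed.

Lemma shift_root_in r : r \in shift_root @: lower Psi -> (r.1 < r.2)%N /\ (r.2 < n)%N.
Proof.
case/imsetP => r0 h ->; have [-> ->] := shift_rootE h; have := lower_lt h.
by have := ltn_ord r0.2; lia.
Qed.

Lemma rser_Rroots : rser (Rroots Psi) = smul (rser col_root) (gser Psi).
Proof.
rewrite smulC RrootsE /gser /rser.
rewrite (eq_bigl (fun r => r \in [predU shift_root @: lower Psi & col_root])); last by move=> r; rewrite !inE.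
rewrite bigU //= disjoint_subset.
apply/subsetP => r /shift_root_in[_ h]; rewrite inE; apply/imsetP => -[i _ e].
by rewrite e ltnn in h.
Qed.

Lemma cyc_pred (j : 'I_n.+1) : (0 < j)%N -> cyc n (inord j.-1) = j.
Proof.
move=> j0; have jn := ltn_ord j; have j1 : (j.-1 < n)%N by lia.
have -> : inord j.-1 = lo (Ordinal j1) by apply: val_inj; rewrite /= inordK //; lia.
by rewrite cyc_lo; apply: val_inj; rewrite /= /bump /=; lia.
Qed.

Lemma sigma_gser k : sigma (gser Psi k) = rser (lower Psi) k.
Proof.
rewrite /gser /rser morph_big big_imset; last exact: shift_root_inj.
congr (_ k); apply: eq_bigr => -[a b] /lower_lt /= h.
by rewrite /root_geom /= fmorph_div !permf_vx !cyc_pred //; lia.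
Qed.

(** Each factor of the row is [x_1] times an inverse variable; homogeneity extracts [x_1^k] and
    leaves a complete homogeneous polynomial in consecutive inverse variables. *)
Lemma rser_row A : (forall j : 'I_n.+1, ((ord0, j) \in Psi) = (A < j)%N) ->
  forall k, (\big[@smul F/sone F]_(r in Psi | ~~ (0 < r.1)%N) root_geom r) k =
    vx ord0 ^+ k * sigma (hh A n k).
Proof.
move=> hA k.
have -> : \big[@smul F/sone F]_(r in Psi | ~~ (0 < r.1)%N) root_geom r =
  \big[@smul F/sone F]_(r in pair (ord0 : 'I_n.+1) @: [set j : 'I_n.+1 | (A < j)%N]) root_geom r.
  apply: eq_bigl => -[a b]; apply/andP/imsetP => [[h /= a0]|[j]]; last first.
    by rewrite inE -hA => h [-> ->].
  have a0' : a = ord0 by apply: val_inj => /=; lia.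
  by exists b; rewrite -?a0' // inE -hA -a0'.
rewrite big_imset /=; last by move=> ? ? _ _ [].
rewrite /root_geom /= scale_big /hh morph_big; congr (_ * _ k).
rewrite [LHS](reindex_inj (@perm_inj _ (cyc n))).
apply: eq_big => [j|j _]; last by rewrite fmorphV permf_vx.
(* The last index is excluded on both sides: [cyc] sends it to the first, which is not beyond
   [A]. *)
rewrite inE; have [jn|jn] := ltnP j n; last first.
  have -> : j = ord_max by apply: val_inj => /=; have := ltn_ord j; lia.
  by rewrite cyc_max /=; lia.
have -> : j = lo (Ordinal jn) by apply: val_inj.
by rewrite cyc_lo /= /bump /=; lia.
Qed.

Lemma rserE A : (forall j : 'I_n.+1, ((ord0, j) \in Psi) = (A < j)%N) -> forall k,
  rser Psi k = \sum_(i < k.+1) vx ord0 ^+ i * sigma (hh A n i * gser Psi (k - i)%N).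
Proof.
move=> hA k; rewrite /rser (bigID (fun r : 'I_n.+1 * 'I_n.+1 => (0 < r.1)%N)) /=.
have -> : \big[@smul F/sone F]_(r in Psi | (0 < r.1)%N) root_geom r = rser (lower Psi).
  by apply: eq_bigl => r; rewrite inE.
rewrite smulC; apply: eq_bigr => i _.
by rewrite (rser_row hA) rmorphM sigma_gser mulrA.
Qed.

(** A root [x_i/x_j] with [i < j] has height [i - j], at most [-1]. As the height is a sum of tails,
    high powers of [q] can only contribute elements of [negs]. *)
Definition height al : int := \sum_(k < n.+1) al`[k] * k%:Z.

Lemma height_wadd al be : height (wadd al be) = height al + height be.
Proof. by rewrite /height -big_split; apply: eq_bigr => k _; rewrite tnth_wadd mulrDl. Qed.

Lemma height_wunit (k : 'I_n.+1) c : height (wunit k c) = c * k%:Z.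
Proof.
rewrite /height (bigD1 k) //= tnth_wunit eqxx big1 ?addr0 // => j /negbTE e.
by rewrite tnth_wunit e mul0r.
Qed.

Lemma height_tail al : height al = \sum_(j < n) tail j.+1 al.
Proof.
rewrite /height /tail (exchange_big_dep xpredT) //=; apply: eq_bigr => k _.
rewrite sumr_const -mulr_natr; congr (_ * _).
have kn : (k <= n)%N by rewrite -ltnS.
rewrite -sum1_card -(big_ord_widen n (fun=> 1%N) kn) sum1_card card_ord.
by rewrite natz.
Qed.

Lemma height_neg al : height al < 0 -> exists j : nat, tail j al < 0.
Proof.
rewrite height_tail => h; case: (pickP (fun j : 'I_n => tail j.+1 al < 0)) => [j hj|no].
  by exists j.+1.
have : 0 <= \sum_(j < n) tail j.+1 al.
  by apply: sumr_ge0 => j _; have := no j; rewrite ltNge => /negbFE.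
lia.
Qed.

Lemma vx_frac (a b : 'I_n.+1) : vx a / vx b = mono (wadd (wunit a 1) (wunit b (-1))).
Proof. by rewrite monoD !mono_unit expr1z exprN1. Qed.

Lemma mono0 : 1 = mono (wunit ord0 0).
Proof. by rewrite mono_unit expr0z. Qed.

Lemma gser_height k : mspan (fun al => lastzero al /\ height al <= - k%:Z) (gser Psi k).
Proof.
apply: (@graded_big F _ _ _ _
  (fun k => mspan (fun al => lastzero al /\ height al <= - k%:Z))) => [k'|||[a b] hr].
- exact: mspan_subgroup.
- rewrite mono0; apply: mspan_gen; rewrite /lastzero tnth_wunit if_same height_wunit.
  by rewrite mul0r.
- move=> a b f g; apply: mspanM => al be [a1 a2] [b1 b2].
  by rewrite /lastzero tnth_wadd a1 b1 height_wadd; split=> //; lia.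
have [/= h1 h2] := shift_root_in hr; rewrite vx_frac; apply: mspan_gen; split.
  rewrite /lastzero tnth_wadd !tnth_wunit !ifF //; apply/negbTE; rewrite -val_eqE /=; lia.
by rewrite height_wadd !height_wunit; lia.
Qed.

Lemma col_last k : mspan (fun al => al`[ord_max] = - k%:Z) (rser col_root k).
Proof.
apply: (@graded_big F _ _ _ _
  (fun k => mspan (fun al => al`[ord_max] = - k%:Z))) => [k'|||r hr].
- exact: mspan_subgroup.
- by rewrite mono0; apply: mspan_gen; rewrite tnth_wunit if_same.
- move=> a b f g; apply: mspanM => al be h1 h2.
  by rewrite tnth_wadd h1 h2; lia.
case/imsetP: hr => i; rewrite inE => hi_ ->; rewrite vx_frac; apply: mspan_gen.
rewrite tnth_wadd !tnth_wunit eqxx ifF //; apply/negbTE; rewrite -val_eqE /=; lia.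
Qed.

Lemma col0 : rser col_root 0 = 1.
Proof.
rewrite /rser; elim/big_rec: _ => // r f _ h.
by rewrite /root_geom smul_geom0.
Qed.

Lemma gser_lastzero be k : lastzero be -> mspan lastzero (gser Psi k * mono be).
Proof.
move=> hb; apply: mspanM (gser_height k) (mspan_gen F hb) => al be' [h _] h'.
by rewrite /lastzero tnth_wadd h h' addr0.
Qed.

(** Once [k] exceeds the absolute height of [be], every monomial has negative height, hence a
    negative tail. *)
Lemma gser_finite be : exists J, forall k, (J <= k)%N -> negs (gser Psi k * mono be).
Proof.
exists (`|height be|.+1)%N => k hk.
apply: (@mspan_negs n F (fun al => height al < 0)); first exact: height_neg.
apply: mspanM (gser_height k) (mspan_gen F (erefl be)) => al be' [_ h] <-.
by rewrite height_wadd; lia.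
Qed.

(** Any factor taken from the last column makes the exponent of [x_l] negative, since nothing else
    involves that variable. *)
Lemma Rroots_negs be k : lastzero be ->
  negs (rser (Rroots Psi) k * mono be - gser Psi k * mono be).
Proof.
move=> hb; rewrite rser_Rroots /smul big_ord_recl col0 mul1r subn0 -mulrBl addrC addKr.
rewrite mulr_suml; apply: subgroup_sum => [|i _]; first exact: negs_subgroup.
rewrite -mulrA; apply: (@mspan_negs n F (fun al => al`[ord_max] < 0)).
  by move=> al h; exists n; rewrite tail_last.
apply: mspanM (col_last _) (gser_lastzero _ hb) => al be' h1 h2.
by rewrite tnth_wadd h1 h2 lift0; lia.
Qed.

End Strict.

Lemma tnth_Rweight_lo ga i : (Rweight ga)`[lo i] = ga`[hi i].
Proof.
rewrite !(tnth_nth 0) /= nth_rcons size_behead size_tuple /= ltn_ord nth_behead.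
by [].
Qed.

Lemma lastzero_Rweight ga : lastzero (Rweight ga).
Proof.
by rewrite /lastzero (tnth_nth 0) /= nth_rcons size_behead size_tuple /= ltnn eqxx.
Qed.

Lemma mono_Rweight ga m : ga`[ord0] = m%:Z ->
  mono ga = vx ord0 ^+ m * sigma (mono (Rweight ga)).
Proof.
move=> h; rewrite permf_mono exprnP -mono_unit -monoD; congr (mono _).
apply: eq_from_tnth => k; rewrite tnth_wadd tnth_wunit tnth_mktuple.
have [->|k0] := eqVneq k ord0; first by rewrite cycV_0 lastzero_Rweight addr0.
have kn : (k.-1 < n)%N by have := ltn_ord k; move: k0; rewrite -val_eqE /=; lia.
have -> : k = hi (Ordinal kn).
  by apply: val_inj; rewrite /= /bump /=; move: k0; rewrite -val_eqE /=; lia.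
by rewrite cycV_hi tnth_Rweight_lo add0r.
Qed.

End RootSeries.

(** * Rotation *)

Lemma skolem (S T : Type) (Q : S -> T -> Prop) :
  (forall x, exists y, Q x y) -> exists f, forall x, Q x (f x).
Proof.
move=> h; exists (fun x => proj1_sig (constructive_indefinite_description _ (h x))) => x.
exact: (proj2_sig (constructive_indefinite_description _ (h x))).
Qed.

Section Rotation.
Variables (n : nat) (F : symField n).
Local Notation "al `[ k ]" := (tnth al k) (at level 2, format "al `[ k ]").
Local Notation mono := (mono F).
Local Notation vx := (vx F).
Local Notation negs := (@negs n F).
Local Notation fpoly := (@fpoly n F).
Local Notation pos := (@mspan n F (fun al => wnonneg al)).
Local Notation sigma := (sf_perm F (cyc n)).
Local Notation tw := (@toW n).

(** [pk j k] is the coefficient of [q^j x_l^k] in the series for [Rroots]. The last clause assembles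
    from the same family the coefficient of [q^k] in the series for [Psi], where a power [x_l^i]
    counts as [q^i x_1^i]. *)
Lemma rotation_series (Psi : rootset n) (ga : weight n) (A m : nat) :
  root_ideal Psi -> (forall j : 'I_n.+1, ((ord0, j) \in Psi) = (A < j)%N) ->
  (A <= n)%N -> ga`[ord0] = m%:Z ->
  exists (pk : nat -> nat -> F) (D : nat), [/\ forall j k, fpoly (pk j k),
    forall j k, (D <= j)%N || (D <= k)%N -> pk j k = 0,
    forall j, exists p, [/\ pos p,
      negs (rser F (Rroots Psi) j * mono (Rweight ga) - p) &
      demw (tw (zword A (n - A))) p = \sum_(k < D) vx ord_max ^+ k * pk j k] &
    forall k, exists q, [/\ pos q, negs (rser F Psi k * mono ga - q) &
      demw (tw (zword A.+1 (n - A.+1))) q =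
        \sum_(i < k.+1) vx ord0 ^+ (m + i) * sigma (pk (k - i)%N i)]].
Proof.
move=> [strict _] hA An hm; have sN := @negs_subgroup n F.
have l0 := lastzero_Rweight ga.
pose G j := gser F Psi j * mono (Rweight ga).
have [p0 /skolem[pk core]] := skolem (fun j =>
  rotation_core An (gser_lastzero F strict j l0)).
have [B0 hB0] : exists B0 : nat -> nat, forall j B, (B0 j <= B)%N ->
    demw (tw (zword A (n - A))) (p0 j) = \sum_(k < B) vx ord_max ^+ k * pk j k.
  pose Q j b := forall B, (b <= B)%N ->
    demw (tw (zword A (n - A))) (p0 j) = \sum_(k < B) vx ord_max ^+ k * pk j k.
  by apply: (skolem (Q := Q)) => j; have [] := core j.
have [J hJ] := gser_finite F strict (Rweight ga).
have pkJ j k : (J <= j)%N -> pk j k = 0.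
  by move=> /hJ Nj; have [_ _ _ /(_ Nj)] := core j.
have pkB j k : (B0 j <= k)%N -> pk j k = 0.
  (* The expansions with [k] and with [k+1] terms agree, so the last term is zero. *)
  move=> h; have := hB0 j k.+1 (leqW h); rewrite (hB0 j k h) big_ord_recr /=.
  move/eqP; rewrite -subr_eq0 opprD addNKr oppr_eq0 mulf_eq0 expf_eq0.
  by rewrite (negbTE (vx_neq0 _ _)) andbF => /eqP.
(* One bound for both indices: beyond [J] all coefficients vanish, and the finitely many earlier
   rows have bounds of their own. *)
pose D := maxn J (\max_(j < J) B0 j).
have hD j : (j < J)%N -> (B0 j <= D)%N.
  by move=> h; rewrite /D leq_max (leq_bigmax (Ordinal h)) orbT.
exists pk, D; split.
- by move=> j k; have [] := core j.
- move=> j k /orP[h|h]; first by apply: pkJ; apply: leq_trans h; exact: leq_maxl.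
  have [|jJ] := leqP J j; first exact: pkJ.
  by apply: pkB; apply: leq_trans h; exact: hD.
- move=> j; have [[f0 N0] _ _ _ _] := core j; exists (p0 j); split.
  + exact: fpoly_pos.
  + rewrite -[_ - _](subrKA (G j)); apply: subgroupD => //; exact: Rroots_negs.
  have [jJ|jJ] := leqP J j; last by apply: hB0; exact: hD.
  rewrite (hB0 j _ (leqnn _)) !big1 // => k _; by rewrite pkJ // mulr0.
move=> k; have /skolem[q hq] : forall i : 'I_k.+1, exists q, [/\ pos q,
    negs (vx ord0 ^+ (m + i) * sigma (hh F A n i * G (k - i)%N) - q) &
    demw (tw (zword A.+1 (n - A.+1))) q = vx ord0 ^+ (m + i) * sigma (pk (k - i)%N i)].
  by move=> i; have [_ _ _ _] := core (k - i)%N; apply.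
exists (\sum_i q i); split.
- apply: subgroup_sum; first exact: mspan_subgroup.
  by move=> i _; have [] := hq i.
- rewrite (rserE F strict hA) (mono_Rweight F hm) mulr_suml -sumrB.
  apply: subgroup_sum => // i _; have [_ + _] := hq i.
  rewrite /G !rmorphM exprD; congr negs; congr (_ - _); ring.
by rewrite raddf_sum; apply: eq_bigr => i _; have [] := hq i.
Qed.

(** * The map [Phi] and coefficients in [q] *)

Definition lift_q (p : {mpoly int[n.+1]}) : qxpoly n := map_mpoly (@polyC int) p.

Lemma lift_q0 : lift_q 0 = 0.
Proof. exact: rmorph0. Qed.
Lemma lift_qB p r : lift_q (p - r) = lift_q p - lift_q r.
Proof. exact: rmorphB. Qed.
Lemma lift_qM p r : lift_q (p * r) = lift_q p * lift_q r.
Proof. exact: rmorphM. Qed.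
Lemma lift_qXn p i : lift_q (p ^+ i) = lift_q p ^+ i.
Proof. exact: rmorphXn. Qed.
Lemma lift_qX m : lift_q 'X_[m] = 'X_[m].
Proof. exact: map_mpolyX. Qed.

Lemma PhiB (P Q : qxpoly n) : Phi (P - Q) = Phi P - Phi Q.
Proof. exact: comp_mpolyB. Qed.
Lemma PhiM (P Q : qxpoly n) : Phi (P * Q) = Phi P * Phi Q.
Proof. exact: rmorphM. Qed.
Lemma PhiXn (P : qxpoly n) i : Phi (P ^+ i) = Phi P ^+ i.
Proof. exact: rmorphXn. Qed.
Lemma PhiZ c (P : qxpoly n) : Phi (c *: P) = c *: Phi P.
Proof. exact: comp_mpolyZ. Qed.
Lemma Phi_sum (I : Type) (r : seq I) (Q : pred I) (G : I -> qxpoly n) :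
  Phi (\sum_(i <- r | Q i) G i) = \sum_(i <- r | Q i) Phi (G i).
Proof. exact: raddf_sum. Qed.

Lemma PhiX_max : Phi 'X_ord_max = 'X *: 'X_ord0 :> qxpoly n.
Proof. by rewrite /Phi comp_mpolyXU -tnth_nth tnth_mktuple /= ltnn. Qed.

Lemma fpoly_lift f : fpoly f ->
  exists r, sf_emb F r = f /\ Phi (lift_q r) = lift_q (msym (cyc n) r).
Proof.
pose P f := exists r, sf_emb F r = f /\ Phi (lift_q r) = lift_q (msym (cyc n) r).
apply: (mspan_sub (P := P)).
  split=> [|f1 f2 [r1 [<- e1]] [r2 [<- e2]]]; first by exists 0; rewrite rmorph0 msym0 lift_q0 /Phi comp_mpoly0.
  exists (r1 - r2); split; first exact: rmorphB.
  by rewrite lift_qB PhiB e1 e2 msymB lift_qB.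
move=> al [/wnonnegP nn l0].
pose mm : 'X_{1..n.+1} := [multinom absz al`[k] | k < n.+1].
exists 'X_[mm]; split.
  by symmetry; apply: mono_emb => k; rewrite mnmE gez0_abs.
rewrite msymX !lift_qX /Phi comp_mpolyX [RHS]mpolyXE_id.
rewrite [RHS](reindex_inj (@perm_inj _ (cyc n))); apply: eq_bigr => k _.
rewrite mnmE permK tnth_mktuple; have [kn|kn] := ltnP k n.
  congr ('X_(_) ^+ _); have -> : k = lo (Ordinal kn) by apply: val_inj.
  by rewrite cyc_lo; apply: val_inj; rewrite /= inordK ?ltnS.
have -> : k = ord_max by apply: val_inj => /=; have := ltn_ord k; lia.
(* The only variable on which [Phi] and [cyc] differ has exponent zero. *)
by rewrite mnmE l0.
Qed.

Lemma qcoefE k P (m : 'X_{1..n.+1}) : (qcoef k P)@_m = (P@_m)`_k.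
Proof. exact: (mcoeff_map_mpoly (coefp k)). Qed.

Fact qcoef_is_zmod_morphism k : zmod_morphism (@qcoef n k).
Proof. by move=> P Q; apply/mpolyP => m; rewrite mcoeffB !qcoefE mcoeffB coefB. Qed.
HB.instance Definition _ k := GRing.isZmodMorphism.Build (qxpoly n) {mpoly int[n.+1]}
  (@qcoef n k) (qcoef_is_zmod_morphism k).

Lemma qcoef_inj (P Q : qxpoly n) : (forall k, qcoef k P = qcoef k Q) -> P = Q.
Proof.
by move=> h; apply/mpolyP => m; apply/polyP => k; rewrite -!qcoefE h.
Qed.

Definition qmon (j : nat) (p : {mpoly int[n.+1]}) : qxpoly n := 'X^j *: lift_q p.

Lemma qcoef_qmon k j p : qcoef k (qmon j p) = if j == k then p else 0.
Proof.
apply/mpolyP => m; rewrite qcoefE mcoeffZ mcoeff_map_mpoly /= coefMC coefXn eq_sym.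
by case: eqP => _; rewrite ?mul1r // mul0r mcoeff0.
Qed.

(** Each power of the last variable contributes one power of [q], which raises the degree from [j]
    to [j + i]. *)
Lemma Phi_qmon j i r : Phi (lift_q r) = lift_q (msym (cyc n) r) ->
  Phi (qmon j ('X_ord_max ^+ i * r)) = qmon (j + i) ('X_ord0 ^+ i * msym (cyc n) r).
Proof.
move=> e; rewrite /qmon PhiZ !lift_qM PhiM !lift_qXn PhiXn e !lift_qX PhiX_max.
by rewrite exprZn -scalerAl scalerA -exprD.
Qed.

Lemma qmonM j p r : lift_q p * qmon j r = qmon j (p * r).
Proof. by rewrite /qmon -scalerAr -lift_qM. Qed.

End Rotation.

(** * Rational functions as an instance, and the theorem *)

Definition ratSF (n : nat) : symField n :=
  @SymField n (ratfun n) (@emb n) (fun s => @permf n s) (@emb_inj n)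
    (@permf_emb n) (@permfM n) (@permf1 n).

Section Concrete.
Variable n : nat.
Local Notation F := (ratSF n).
Local Notation pos := (@mspan n F (fun al => wnonneg al)).
Local Notation negs := (@negs n F).

Lemma pi1_dem i (f : ratfun n) : pi1 i f = dem (F := F) i f.
Proof. by rewrite /dem /ddiv /= /permf. Qed.

Lemma pi_word_demw u (f : ratfun n) : pi_word u f = demw (F := F) u f.
Proof. by elim: u => //= i u ->; rewrite pi1_dem. Qed.

Lemma pi_op_demw u (f : ratfun n) : pi_op (helt u) f = demw (F := F) u f.
Proof. by rewrite /pi_op pi_word_demw; exact: (@demw_eq n F _ _ f (repr_helt u)). Qed.

Lemma key_kap (al : weight n) : key al = kap F al.
Proof. by rewrite kapE /key /pi_op pi_word_demw. Qed.

(** Any decomposition into a polynomial and an element of [negs] computes [poly], whichever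
    coefficients [keycoef] selects. *)
Lemma poly_partE (p g : F) : pos p -> negs g -> poly_part (p + g) = p.
Proof.
move=> hp hg; have [c hc] := keysum_ex hp hg.
have ks (d : {fsfun weight n -> int with 0}) :
    keysum d = \sum_(al <- finsupp d) kap F al *~ d al.
  by apply: eq_bigr => al _; rewrite key_kap.
have : exists d : {fsfun weight n -> int with 0}, keysum d = p + g.
  by exists c; rewrite ks.
move/(epsilon_spec (inhabits [fsfun])); rewrite -/(keycoef (p + g)) ks => e.
rewrite -[RHS](@keysum_pos n F _ _ _ e hp hg) /poly_part.
by apply: eq_bigr => al _; rewrite key_kap.
Qed.

Lemma Hseries_eval (Psi : rootset n) (ga : weight n) u k (p : F) : pos p ->
  negs (rser F Psi k * mono F ga - p) -> Hseries Psi ga (helt u) k = demw u p.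
Proof.
move=> hp hn; rewrite /Hseries pi_op_demw.
have e : root_series Psi ga k = p + (rser F Psi k * mono F ga - p).
  by rewrite [RHS]addrC subrK.
by rewrite e (poly_partE hp hn).
Qed.

Lemma qcoef_sum k (I : Type) (r : seq I) (Q : pred I) (G : I -> qxpoly n) :
  qcoef k (\sum_(i <- r | Q i) G i) = \sum_(i <- r | Q i) qcoef k (G i).
Proof. exact: raddf_sum. Qed.

Lemma emb_sum (I : Type) (r : seq I) (Q : pred I) (G : I -> {mpoly int[n.+1]}) :
  emb (\sum_(i <- r | Q i) G i) = \sum_(i <- r | Q i) emb (G i).
Proof. exact: raddf_sum. Qed.

Lemma emb_monoM k i (p : {mpoly int[n.+1]}) : emb ('X_k ^+ i * p) = vx F k ^+ i * emb p.
Proof. by rewrite rmorphM rmorphXn. Qed.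

(** An explicit candidate [P] gives existence for [epsilon], and the coefficients in [q] determine
    the polynomial. *)
Lemma Hcat_unique (Psi : rootset n) (ga : weight n) w (P : qxpoly n) :
  (forall k, emb (qcoef k P) = Hseries Psi ga w k) -> Hcat Psi ga w = P.
Proof.
move=> h; apply: qcoef_inj => k; apply: emb_inj; rewrite h.
exact: (epsilon_spec (inhabits (0 : qxpoly n))
  (fun P => forall k, emb (qcoef k P) = Hseries Psi ga w k) (ex_intro _ P h) k).
Qed.

End Concrete.

(** Since [t] vanishes outside the square of side [D], the antidiagonal may be cut by the square or
    run in full. *)
Lemma sum_antidiagonal (V : zmodType) (t : nat -> nat -> V) (D k : nat) :
  (forall j i, (D <= j)%N || (D <= i)%N -> t j i = 0) ->
  \sum_(j < D) \sum_(i < D) (if (j + i == k)%N then t j i else 0) =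
  \sum_(i < k.+1) t (k - i)%N i.
Proof.
move=> t0; pose s i := if (i <= k)%N then t (k - i)%N i else 0.
have s0 i : (D <= i)%N -> s i = 0 by move=> h; rewrite /s t0 ?h ?orbT // if_same.
rewrite exchange_big /=.
have -> : \sum_(i < D) \sum_(j < D) (if (j + i == k)%N then t j i else 0) = \sum_(i < D) s i.
  apply: eq_bigr => i _; rewrite /s; case: leqP => ik.
    have [kD|Dk] := ltnP (k - i)%N D; last first.
      rewrite t0 ?Dk // big1 // => j _; rewrite ifF //; apply/eqP; have := ltn_ord j; lia.
    rewrite (bigD1 (Ordinal kD)) //= subnK // eqxx big1 ?addr0 // => j.
    rewrite -val_eqE /= => /eqP h; rewrite ifF //; apply/eqP; lia.
  by rewrite big1 // => j _; rewrite ifF //; apply/eqP; lia.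
transitivity (\sum_(i < D + k.+1) s i).
  rewrite big_split_ord /= [X in _ + X]big1 ?addr0 // => i _.
  by apply: s0; exact: leq_addr.
rewrite addnC big_split_ord /= [X in _ + X]big1 ?addr0.
  by apply: eq_bigr => i _; rewrite /s -ltnS ltn_ord.
by move=> i _; rewrite /s ifF //; apply/negbTE; rewrite -ltnNge; lia.
Qed.

Theorem theorem5p14 (n : nat) (gamma : weight n) (Psi : rootset n)
    (hgamma : 0 <= thead gamma) (hPsi : root_ideal Psi) :
  let a := nr1 Psi in
  Hcat Psi gamma (w0 n a.+1 n.+1) =
  'X_ord0 ^+ `|thead gamma|%N *
    Phi (Hcat (Rroots Psi) (Rweight gamma) (w0 n a n.+1)).
Proof.
have [A [-> An] hA] := nr1P hPsi => /=; set m := `|thead gamma|%N.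
have hm : tnth gamma ord0 = m%:Z by rewrite gez0_abs.
have [pk [D [h1 h2 h3 h4]]] := rotation_series (ratSF n) hPsi hA An hm.
have [r hr] : exists r : nat * nat -> {mpoly int[n.+1]}, forall x,
    emb (r x) = pk x.1 x.2 /\ Phi (lift_q (r x)) = lift_q (msym (cyc n) (r x)).
  pose Q (x : nat * nat) (y : {mpoly int[n.+1]}) :=
    emb y = pk x.1 x.2 /\ Phi (lift_q y) = lift_q (msym (cyc n) y).
  by apply: (skolem (Q := Q)) => x; exact: fpoly_lift (h1 x.1 x.2).
have r0 j i : (D <= j)%N || (D <= i)%N -> r (j, i) = 0.
  by move=> h; apply: emb_inj; rewrite (hr (j, i)).1 h2 // rmorph0.
(* The rotated Catalan function written out; [j] counts powers of [q] and [i] those of [x_l]. *)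
pose P : qxpoly n := \sum_(j < D) \sum_(i < D) qmon j ('X_ord_max ^+ i * r (j : nat, i : nat)).
have w0A : w0 n A.+1 n.+1 = helt (toW n (zword A (n - A))).
  by apply: w0E => [|k]; [lia | have := ltn_ord k; lia].
have w0A' : w0 n A.+2 n.+1 = helt (toW n (zword A.+1 (n - A.+1))).
  (* For [A = n] the interval is empty and [A.+1] is out of range for [w0E], so the empty word is
     presented with [p = d = 0]. *)
  have [e|ne] := eqVneq A n.
    rewrite e (_ : (n - n.+1)%N = 0%N); last lia.
    by apply: (@w0E n n.+2 n.+1 0 0) => // k; have := ltn_ord k; lia.
  by apply: w0E => [|k]; [lia | have := ltn_ord k; lia].
have -> : Hcat (Rroots Psi) (Rweight gamma) (w0 n A.+1 n.+1) = P.
  apply: Hcat_unique => k; have [p [hp hn hw]] := h3 k.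
  rewrite w0A (Hseries_eval _ hp hn) hw.
  have -> : \sum_(i < D) vx (ratSF n) ord_max ^+ i * pk k i =
      emb (\sum_(i < D) 'X_ord_max ^+ i * r (k, i : nat)).
    by rewrite emb_sum; apply: eq_bigr => i _; rewrite emb_monoM (hr (k, i : nat)).1.
  apply: (congr1 (@emb n)); rewrite /P qcoef_sum.
  have [kD|Dk] := ltnP k D.
    rewrite (bigD1 (Ordinal kD)) //= [X in _ + X]big1 ?addr0.
      by rewrite qcoef_sum; apply: eq_bigr => i _; rewrite qcoef_qmon eqxx.
    move=> j; rewrite -val_eqE /= => jk; rewrite qcoef_sum big1 // => i _.
    by rewrite qcoef_qmon (negbTE jk).
  rewrite [RHS]big1; last by move=> i _; rewrite r0 ?Dk // mulr0.
  rewrite big1 // => j _; rewrite qcoef_sum big1 // => i _.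
  by rewrite qcoef_qmon ifF //; apply/eqP; have := ltn_ord j; lia.
apply: Hcat_unique => k; have [q [hq hn hw]] := h4 k.
rewrite w0A' (Hseries_eval _ hq hn) hw.
have -> : 'X_ord0 ^+ m * Phi P = \sum_(j < D) \sum_(i < D)
    qmon (j + i) ('X_ord0 ^+ (m + i) * msym (cyc n) (r (j : nat, i : nat))).
  rewrite /P Phi_sum mulr_sumr; apply: eq_bigr => j _.
  rewrite Phi_sum mulr_sumr; apply: eq_bigr => i _.
  rewrite (Phi_qmon _ _ (hr (j : nat, i : nat)).2) -(lift_qX (U_(ord0))) -lift_qXn qmonM.
  by rewrite mulrA -exprD.
(* The sum for [q^k] runs over an antidiagonal; rewriting it over the square matches the terms of
   [Phi P] of degree [j + i = k]. *)
rewrite -(@sum_antidiagonal _ (fun j i => vx (ratSF n) ord0 ^+ (m + i) *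
  sf_perm (ratSF n) (cyc n) (pk j i)) D); last first.
  by move=> j i h; rewrite h2 // rmorph0 mulr0.
rewrite qcoef_sum emb_sum; apply: eq_bigr => j _.
rewrite qcoef_sum emb_sum; apply: eq_bigr => i _.
rewrite qcoef_qmon; case: eqP => _; last exact: rmorph0.
by rewrite emb_monoM -permf_emb (hr (j : nat, i : nat)).1.
Qed.
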